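(* Let $A$ be a Noetherian one-dimensional domain of prime characteristic $p$ which is either a complete local domain with residue field $k$, or an $\mathbb N$-graded domain $A=\bigoplus_{i\ge 0}A_i$ with $A_0=k$ a field. If $k$ is a finite field, then $A$ has finite F-representation type.
   Context: All rings are commutative Noetherian of prime characteristic $p$; $\mathbb N=\{0,1,2,\dots\}$. For an $\mathbb N$-graded ring $A=\bigoplus_{i\ge0}A_i$ it is assumed that $\gcd\{i\mid A_i\ne 0\}=1$. For an $A$-module $M$ and $e\in\mathbb N$, ${}^eM$ denotes the $A$-module which equals $M$ as an abelian group, with $A$-action $a\cdot m:=a^{p^e}m$. The ring $A$ has finite F-representation type if there are finitely many finitely generated $A$-modules $M_1,\dots,M_s$ such that for every $e\in\mathbb N$ there are nonnegative integers $n_{e,1},\dots,n_{e,s}$ with ${}^eA\cong\bigoplus_{i=1}^s M_i^{\oplus n_{e,i}}$ as $A$-modules. *)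

(* Defs.v *)
From HB Require Import structures.
From mathcomp Require Export all_boot all_order all_algebra.

Set Implicit Arguments.
Unset Strict Implicit.
Unset Printing Implicit Defensive.

Import GRing.Theory.

Local Open Scope ring_scope.

(* [idealr A] and [prime_idealr A] are the proper ideals and proper prime
   ideals; omitting the (principal) unit ideal here loses nothing. *)
Definition noetherian (A : comNzRingType) : Prop :=
  forall I : idealr A, exists s : seq A, forall x : A,
    x \in I <-> exists c : 'I_(size s) -> A, x = \sum_i c i * s`_i.

Definition prime_chain (A : comNzRingType) (n : nat)
    (P : 'I_n.+1 -> prime_idealr A) : Prop :=
  forall i j : 'I_n.+1, (i < j)%N ->
    {subset P i <= P j} /\ ~ {subset P j <= P i}.

Definition krull_dim_eq (A : comNzRingType) (d : nat) : Prop :=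
  (exists P : 'I_d.+1 -> prime_idealr A, prime_chain P) /\
  (forall (n : nat) (P : 'I_n.+1 -> prime_idealr A),
     prime_chain P -> (n <= d)%N).

Definition maximal_ideal (A : comNzRingType) (m : idealr A) : Prop :=
  forall J : idealr A, {subset m <= J} -> {subset J <= m}.

Definition local_ring (A : comNzRingType) (m : idealr A) : Prop :=
  maximal_ideal m /\ forall J : idealr A, maximal_ideal J -> J =i m.

Fixpoint ideal_pow (A : comNzRingType) (I : {pred A}) (n : nat) : A -> Prop :=
  if n is n'.+1 then
    fun x => exists s : seq (A * A),
      (forall u, u \in s -> u.1 \in I /\ ideal_pow I n' u.2) /\
      x = \sum_(u <- s) u.1 * u.2
  else fun _ => True.

(* Bijectivity of A -> lim_n A/I^n: a compatible family of residue classes is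
   given by representatives [a n]; uniqueness of [x] is separatedness. *)
Definition adically_complete (A : comNzRingType) (I : {pred A}) : Prop :=
  forall a : nat -> A,
    (forall n, ideal_pow I n (a n.+1 - a n)) ->
    exists! x : A, forall n, ideal_pow I n (x - a n).

Definition complete_local (A : comNzRingType) (k : fieldType) : Prop :=
  exists m : idealr A,
    [/\ local_ring m,
        adically_complete m
      & exists f : {rmorphism {ideal_quot m} -> k}, bijective f].

(* The last two fields say that A is the internal direct sum of the G i. *)
Record grading (A : comNzRingType) (G : nat -> {pred A}) : Prop := Grading {
  grading_zmod : forall i, zmod_closed (G i);
  grading_one : 1 \in G 0%N;
  grading_mul : forall i j,
    {in G i & G j, forall x y, x * y \in G (i + j)%N};
  grading_span : forall a : A, exists (n : nat) (x : nat -> A),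
    (forall i, x i \in G i) /\ a = \sum_(i < n) x i;
  grading_indep : forall (n : nat) (x : nat -> A),
    (forall i, x i \in G i) -> \sum_(i < n) x i = 0 ->
    forall i, (i < n)%N -> x i = 0
}.

Definition is_gcd (S : nat -> Prop) (g : nat) : Prop :=
  (forall i, S i -> (g %| i)%N) /\
  (forall d, (forall i, S i -> (d %| i)%N) -> (d %| g)%N).

Definition graded_over (A : comNzRingType) (k : fieldType) : Prop :=
  exists G : nat -> {pred A},
    [/\ grading G,
        is_gcd (fun i => exists2 x, x \in G i & x != 0) 1
      & exists iota : {rmorphism k -> A},
          forall x : A, x \in G 0%N <-> exists c : k, x = iota c].

(* The module written ^eM. *)
Definition frob_mod (A : comNzRingType) (p : nat) (charA : p \in [pchar A])
  (e : nat) (M : lmodType A) : Type := M.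

Section FrobMod.
Variables (A : comNzRingType) (p : nat) (charA : p \in [pchar A]) (e : nat).
Variable M : lmodType A.
Local Notation eM := (frob_mod charA e M).

HB.instance Definition _ := GRing.Zmodule.copy eM M.

Definition frob_scale (a : A) (m : eM) : eM := (a ^+ (p ^ e)) *: (m : M).

Fact frob_scaleA a b m :
  frob_scale a (frob_scale b m) = frob_scale (a * b) m.
Proof. by rewrite /frob_scale scalerA exprMn. Qed.

Fact frob_scale1 : left_id 1 frob_scale.
Proof. by move=> m; rewrite /frob_scale expr1n scale1r. Qed.

Fact frob_scaleDr : right_distributive frob_scale +%R.
Proof. by move=> a x y; rewrite /frob_scale scalerDr. Qed.

Fact frob_scaleDl m : {morph frob_scale^~ m : a b / a + b}.
Proof.
move=> a b; rewrite /frob_scale exprDn_pchar ?scalerDl //.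
by rewrite pnatX orbC pnatE ?(pcharf_prime charA) ?charA ?orbT.
Qed.

HB.instance Definition _ := GRing.Zmodule_isLmodule.Build A eM
  frob_scaleA frob_scale1 frob_scaleDr frob_scaleDl.
End FrobMod.

(* Direct sum of a finite family of modules; the library has no module
   structure on dependent finite functions. *)
Definition dsum (A : comNzRingType) (I : finType) (M : I -> lmodType A) : Type :=
  {dffun forall i : I, M i}.

Section DSum.
Variables (A : comNzRingType) (I : finType) (M : I -> lmodType A).
Local Notation D := (dsum M).

HB.instance Definition _ := Choice.copy D {dffun forall i : I, M i}.

Definition dsum_zero : D := [ffun i => 0 : M i].
Definition dsum_opp (x : D) : D := [ffun i => - x i : M i].
Definition dsum_add (x y : D) : D := [ffun i => x i + y i : M i].
Definition dsum_scale (a : A) (x : D) : D := [ffun i => a *: x i : M i].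

Fact dsum_addA : associative dsum_add.
Proof. by move=> x y z; apply/ffunP=> i; rewrite !ffunE addrA. Qed.

Fact dsum_addC : commutative dsum_add.
Proof. by move=> x y; apply/ffunP=> i; rewrite !ffunE addrC. Qed.

Fact dsum_add0 : left_id dsum_zero dsum_add.
Proof. by move=> x; apply/ffunP=> i; rewrite !ffunE add0r. Qed.

Fact dsum_addN : left_inverse dsum_zero dsum_opp dsum_add.
Proof. by move=> x; apply/ffunP=> i; rewrite !ffunE addNr. Qed.

HB.instance Definition _ := GRing.isZmodule.Build D
  dsum_addA dsum_addC dsum_add0 dsum_addN.

Fact dsum_scaleA a b x :
  dsum_scale a (dsum_scale b x) = dsum_scale (a * b) x.
Proof. by apply/ffunP=> i; rewrite !ffunE scalerA. Qed.

Fact dsum_scale1 : left_id 1 dsum_scale.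
Proof. by move=> x; apply/ffunP=> i; rewrite !ffunE scale1r. Qed.

Fact dsum_scaleDr : right_distributive dsum_scale +%R.
Proof. by move=> a x y; apply/ffunP=> i; rewrite !ffunE scalerDr. Qed.

Fact dsum_scaleDl x : {morph dsum_scale^~ x : a b / a + b}.
Proof. by move=> a b; apply/ffunP=> i; rewrite !ffunE scalerDl. Qed.

HB.instance Definition _ := GRing.Zmodule_isLmodule.Build A D
  dsum_scaleA dsum_scale1 dsum_scaleDr dsum_scaleDl.
End DSum.

Definition fg_module (A : comNzRingType) (M : lmodType A) : Prop :=
  exists s : seq M, forall x : M,
    exists c : 'I_(size s) -> A, x = \sum_i c i *: s`_i.

Definition iso_module (A : comNzRingType) (U V : lmodType A) : Prop :=
  exists f : {linear U -> V}, bijective f.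

(* [A^o] is A as a module over itself; [{ffun 'I_n -> M}] is M^n. *)
Definition finite_F_representation_type (A : comNzRingType) (p : nat)
    (charA : p \in [pchar A]) : Prop :=
  exists (s : nat) (M : 'I_s -> lmodType A),
    (forall i, fg_module (M i)) /\
    forall e : nat, exists n : 'I_s -> nat,
      iso_module (frob_mod charA e A^o)
                 (dsum (fun i => {ffun 'I_(n i) -> M i} : lmodType A)).

(* Main.v *)
From HB Require Import structures.
Require Import Defs.
From mathcomp Require Import boolp zify ring generic_quotient.

Set Implicit Arguments.
Unset Strict Implicit.
Unset Printing Implicit Defensive.

Import Order.TTheory GRing.Theory Num.Theory.
Local Open Scope ring_scope.
Local Notation "x %:F" := (FracField.tofrac x).

(** Let [B] be the integral closure of [A] in its fraction field [K]. Because
    [k] is finite, [B] is a power series ring [k'[[t]]] or a polynomial ring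
    [k'[t]] over a finite, hence perfect, field [k'], and some [t ^ c] lies in
    the conductor of [B] over [A]. For [q = p ^ e] every element of [B] is
    uniquely [\sum_(i < q) t ^+ i * b_i ^+ q] with [b_i] in [B]. In these
    coordinates [A] acts on [^eB] as it does on [B ^ q], and as soon as [q >= c]
    the condition that an element lies in [A] involves only the residues modulo
    [t] of [b_0, ..., b_(c - 1)]. So [^eA] is the sum of [q - c] copies of [B]
    and of a submodule of [B ^ c] which contains [(t B) ^ c]; as [B / t B] is
    finite, only finitely many such submodules occur. This is
    [ffrt_of_frobenius_parameter], stated for a subring [B] of [K] with an
    element [t] that has these properties.

    It remains to exhibit [B] and [t]. By
    Noetherian induction ([oka_induction]) every nonzero principal ideal of a
    complete local [A] as in the theorem has finite index, and the index is
    multiplicative, so its inverse extends to an absolute value on [K]. Since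
    [A] is complete, elements of large index are divisible by a fixed nonzero
    nonunit [x] ([dvr_of_large_index], a compactness argument), whence the unit
    ball has bounded denominators ([abs_conductor]). The ultrametric inequality
    follows, as [q]-th powers are additive and an element of absolute value
    greater than [1] has unbounded powers ([absD_le1]). So [B] is the unit ball,
    a complete discrete valuation ring.

    In the graded case there are homogeneous elements of consecutive degrees,
    and their quotient [t] has degree one. The homogeneous fractions of degree
    [0] whose denominator is a power of a fixed homogeneous [x] of positive
    degree form a finite domain [k'], since [A / x A] is finite, and [B] is
    [k'[t]]. *)

(** * Module isomorphisms *)

Section Isomorphisms.
Variable A : comNzRingType.
Implicit Types U V W : lmodType A.

(** The decomposition of [^eA] below is described by an equation between an
    element of one module and the coordinates of an element of the other; neither
    direction has a formula. *)
Lemma iso_of_linear_rel U V (R : U -> V -> Prop) :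
    (forall a u u' v v', R u v -> R u' v' -> R (a *: u + u') (a *: v + v')) ->
    (forall u, exists v, R u v) -> (forall v, exists u, R u v) ->
    (forall u, R u 0 -> u = 0) -> (forall v, R 0 v -> v = 0) ->
  iso_module U V.
Proof.
move=> Rlin Rl Rr R0l R0r.
have [f Rf] := choice Rl; have [g Rg] := choice Rr.
have RB u u' v v' : R u v -> R u' v' -> R (u - u') (v - v').
  by move=> h h'; rewrite addrC [v - v']addrC -!scaleN1r; apply: Rlin.
have R_funr u v v' : R u v -> R u v' -> v = v'.
  by move=> h h'; apply/subr0_eq/R0r; have := RB _ _ _ _ h h'; rewrite subrr.
have R_funl u u' v : R u v -> R u' v -> u = u'.
  by move=> h h'; apply/subr0_eq/R0l; have := RB _ _ _ _ h h'; rewrite subrr.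
have f_lin : linear f.
  by move=> a u u'; apply: R_funr (Rf _) _; apply: Rlin.
pose fL : {linear U -> V} := HB.pack f (GRing.isLinear.Build A U V *:%R f f_lin).
exists fL, g => [u|v]; first exact: R_funl (Rg _) (Rf u).
exact: R_funr (Rf _) (Rg v).
Qed.

Lemma iso_module_refl U : iso_module U U.
Proof. by exists idfun, idfun. Qed.

Lemma iso_module_trans V U W : iso_module U V -> iso_module V W -> iso_module U W.
Proof. by move=> [f bf] [g bg]; exists (g \o f)%FUN; apply: bij_comp. Qed.

Lemma iso_prod U U' V V' :
  iso_module U U' -> iso_module V V' -> iso_module (U * V)%type (U' * V')%type.
Proof.
move=> [f [f' fK f'K]] [g [g' gK g'K]].
apply: (iso_of_linear_rel
  (R := fun u v => v = (f u.1, g u.2) :> U' * V')) => [a u u' v v' -> ->|u|v|u|v].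
- by rewrite !linearP.
- by eexists.
- by exists (f' v.1, g' v.2); rewrite /= f'K g'K; case: v.
- case: u => u w [/esym/(canRL fK)-> /esym/(canRL gK)->].
  by rewrite -{1}(linear0 f) -(linear0 g) fK gK.
- by move=> ->; rewrite !linear0.
Qed.

Lemma iso_ffun1 n V : n = 1%N -> iso_module V {ffun 'I_n -> V}.
Proof.
move=> ->; apply: (iso_of_linear_rel (R := fun v (f : {ffun 'I_1 -> V}) => f ord0 = v)).
- by move=> a f f' v v' <- <-; rewrite !ffunE.
- by move=> v; exists [ffun=> v]; rewrite ffunE.
- by move=> f; exists (f ord0).
- by move=> v <-; rewrite ffunE.
- by move=> f f0; apply/ffunP=> i; rewrite ord1 f0 ffunE.
Qed.

(** Only two summands of the sum contribute; the inverse of the projection to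
    them overwrites two coordinates of the zero family. *)
Lemma iso_dsum2 (I : finType) (X : I -> lmodType A) (i0 i1 : I) :
    i0 != i1 -> (forall i, i != i0 -> i != i1 -> forall x : X i, x = 0) ->
  iso_module (X i0 * X i1)%type (dsum X).
Proof.
move=> i01 X0.
apply: (iso_of_linear_rel (R := fun u (d : dsum X) => u = (d i0, d i1))).
- by move=> a u u' d d' -> ->; rewrite !ffunE.
- move=> [u v]; pose d i := dfwith (dfwith (fun i => 0 : X i) u) v i.
  exists (finfun d : dsum X); rewrite /= !ffunE /d dfwith_in.
  by rewrite dfwith_out 1?eq_sym// dfwith_in.
- by move=> d; eexists.
- by move=> u ->; rewrite !ffunE.
- move=> d [d0 d1]; apply/ffunP => i; rewrite !ffunE.
  have [->|i_0] := eqVneq i i0; first by rewrite -d0.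
  by have [->|i_1] := eqVneq i i1; [rewrite -d1 | apply: X0].
Qed.

End Isomorphisms.

Section Criterion.
Variables (A : comNzRingType) (p : nat) (charA : p \in [pchar A]).

(** The remainders need only be finitely many up to isomorphism: [f] records a
    finite invariant, and the list of modules has one representative per value
    of it. *)
Lemma ffrt_of_finite_remainders (B : lmodType A) (N : nat -> lmodType A)
    (T : finType) (f : nat -> T) :
    fg_module B -> (forall e, fg_module (N e)) ->
    (forall e e', f e = f e' -> iso_module (N e) (N e')) ->
    (forall e, exists n,
       iso_module (frob_mod charA e A^o) ({ffun 'I_n -> B} * N e)%type) ->
  finite_F_representation_type charA.
Proof.
move=> Bfg Nfg Nf dec.
have /choice[rep repP] (j : 'I_#|T|) :
    exists r, (exists e, f e = enum_val j) -> f r = enum_val j.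
  have [[e fe]|ne] := pselect (exists e, f e = enum_val j); first by exists e.
  by exists 0%N.
pose M (i : 'I_#|T|.+1) : lmodType A :=
  match i with @Ordinal _ 0 _ => B | @Ordinal _ j.+1 h => N (rep (@Ordinal #|T| j h)) end.
exists #|T|.+1, M; split=> [[[|j] h] //|e]; first exact: Nfg.
have [n iso_e] := dec e.
pose j0 := enum_rank (f e); pose i1 : 'I_#|T|.+1 := Ordinal (ltn_ord j0 : j0.+1 < #|T|.+1)%N.
pose m (i : 'I_#|T|.+1) := if i == ord0 then n else (i == i1) : nat.
exists m; apply: iso_module_trans iso_e _.
apply: iso_module_trans (iso_dsum2 (X := fun i => {ffun 'I_(m i) -> M i})
  (i0 := ord0) (i1 := i1) isT _); last first.
  move=> i i_0 i_1 x; apply/ffunP=> -[k hk]; exfalso.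
  by move: hk; rewrite /m (negPf i_0) (negPf i_1).
apply: iso_prod; first exact: iso_module_refl.
have m1 : m i1 = 1%N by rewrite /m eqxx.
apply: iso_module_trans (iso_ffun1 _ m1) => /=.
have -> : @Ordinal #|T| j0 (ltn_ord j0) = j0 by apply: val_inj.
by apply: Nf; rewrite repP; [|exists e]; rewrite enum_rankK.
Qed.

End Criterion.

(** * Ideals of Noetherian rings *)

Section Ideals.
Variable A : comNzRingType.
Implicit Types (I J P : A -> Prop) (a b x y : A).

Definition is_ideal I := I 0 /\ forall a x y, I x -> I y -> I (a * x + y).
Definition is_prime P :=
  [/\ is_ideal P, ~ P 1 & forall a b, P (a * b) -> P a \/ P b].

Lemma idealM I a x : is_ideal I -> I x -> I (a * x).
Proof. by move=> [I0 IL] Ix; rewrite -[_ * _]addr0; apply: IL. Qed.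

Lemma idealD I x y : is_ideal I -> I x -> I y -> I (x + y).
Proof. by move=> [I0 IL] Ix Iy; rewrite -[x]mul1r; apply: IL. Qed.

Lemma idealB I x y : is_ideal I -> I x -> I y -> I (x - y).
Proof. by move=> hI Ix Iy; rewrite -[- y]mulN1r; apply: idealD => //; apply: idealM. Qed.

Definition ideal_pred I (hI : is_ideal I) (h1 : ~ I 1) : {pred A} :=
  fun x => `[< I x >].

Fact ideal_pred_closed I hI h1 : idealr_closed (@ideal_pred I hI h1).
Proof.
split=> [||a x y]; first exact/asboolP/hI.1.
  by apply/negP => /asboolP.
by move=> /asboolP Ix /asboolP Iy; apply/asboolP; apply: hI.2.
Qed.

HB.instance Definition _ I hI h1 :=
  isIdealr.Build A (@ideal_pred I hI h1) (@ideal_pred_closed I hI h1).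

Definition prime_pred P (hP : is_prime P) : {pred A} := fun x => `[< P x >].

Fact prime_pred_closed P hP : idealr_closed (@prime_pred P hP).
Proof. by case: hP => hI h1 hM; apply: (@ideal_pred_closed P hI h1). Qed.

Fact prime_pred_prime P hP : prime_idealr_closed (@prime_pred P hP).
Proof.
case: hP => hI h1 hM a b /asboolP/hM[Pa|Pb]; apply/orP; [left|right]; exact/asboolP.
Qed.

HB.instance Definition _ P hP :=
  isIdealr.Build A (@prime_pred P hP) (@prime_pred_closed P hP).
HB.instance Definition _ P hP :=
  isPrimeIdealrClosed.Build A (@prime_pred P hP) (@prime_pred_prime P hP).

Lemma is_ideal_idealr (I : idealr A) : is_ideal (fun x => x \in I).
Proof.
split=> [|a x y Ix Iy]; first exact: idealr0.
by rewrite rpredD// idealMr.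
Qed.

Lemma is_prime_idealr (P : prime_idealr A) : is_prime (fun x => x \in P).
Proof.
split=> [||a b]; [exact: is_ideal_idealr | by rewrite idealr1 |].
by rewrite prime_idealrM => /orP.
Qed.

Lemma principal_is_ideal x : is_ideal (fun z => exists c, z = c * x).
Proof.
split; first by exists 0; rewrite mul0r.
by move=> a _ _ [c ->] [d ->]; exists (a * c + d); ring.
Qed.

Lemma colon_is_ideal I a : is_ideal I -> is_ideal (fun z => I (a * z)).
Proof.
move=> hI; split=> [|b x y Ix Iy]; first by rewrite mulr0; apply: hI.1.
by rewrite mulrDr mulrCA; apply: hI.2.
Qed.

Lemma adjoin_is_ideal I a : is_ideal I -> is_ideal (fun z => exists r, I (z - r * a)).
Proof.
move=> hI; split; first by exists 0; rewrite mul0r subrr; apply: hI.1.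
move=> b x y [r Ir] [s Is]; exists (b * r + s).
suff -> : b * x + y - (b * r + s) * a = b * (x - r * a) + (y - s * a) by apply: hI.2.
by ring.
Qed.

Section Span.
Variable V : lmodType A.
Implicit Type s : seq V.

Fixpoint span s (v : V) : Prop :=
  if s is g :: s' then exists a : A, span s' (v - a *: g) else v = 0.

Lemma spanP s v : span s v <-> exists c : 'I_(size s) -> A, v = \sum_i c i *: s`_i.
Proof.
elim: s v => [|g s IH] v /=.
  by split=> [->|[c ->]]; [exists (fun=> 0)|]; rewrite big_ord0.
split=> [[a /IH[c vE]]|[c ->]].
  exists (fun i => if unlift ord0 i is Some j then c j else a).
  rewrite big_ord_recl/= unlift_none -[v](subrK (a *: g)) vE addrC.
  by congr (_ + _); apply: eq_bigr => i _; rewrite liftK.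
exists (c ord0); apply/IH; exists (fun i => c (lift ord0 i)).
by rewrite big_ord_recl/= addrC addKr.
Qed.

Definition is_submod (S : V -> Prop) :=
  S 0 /\ forall a u v, S u -> S v -> S (a *: u + v).

Lemma span_submod s : is_submod (span s).
Proof.
elim: s => [|g s [IH0 IHL]] /=.
  by split=> // a u v -> ->; rewrite scaler0 addr0.
split=> [|a u v [b bu] [c cv]]; first by exists 0; rewrite scale0r subr0.
exists (a * b + c).
suff -> : a *: u + v - (a * b + c) *: g = a *: (u - b *: g) + (v - c *: g) by apply: IHL.
by rewrite scalerBr scalerDl scalerA opprD addrACA.
Qed.

Lemma span_sub S s v : is_submod S -> {in s, forall g, S g} -> span s v -> S v.
Proof.
move=> [S0 SL]; elim: s v => [|g s IH] v sS /= => [->//|[a /IH Sv]].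
rewrite -[v](subrK (a *: g)) addrC; apply: SL; first by apply: sS; rewrite inE eqxx.
by apply: Sv => h hs; apply: sS; rewrite inE hs orbT.
Qed.

Lemma mem_span s g : g \in s -> span s g.
Proof.
elim: s => //= h s IH; rewrite inE => /predU1P[->|/IH sg].
  by exists 1; rewrite scale1r subrr; apply: (span_submod s).1.
by exists 0; rewrite scale0r subr0.
Qed.

End Span.

Hypothesis noethA : noetherian A.

Lemma noetherian_span I : is_ideal I ->
  exists s : seq A^o, forall x, I x <-> span s x.
Proof.
move=> hI; have [I1|I1] := pselect (I 1).
  exists [:: 1]; move=> x; split=> [_|/span_sub]; last first.
    by apply; [exact: hI | move=> g; rewrite inE => /eqP->].
  by exists x; rewrite /= [x *: _]mulr1 subrr.
have [s sP] := noethA (ideal_pred hI I1).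
exists s => x; rewrite spanP -[I x](asboolE) -[X in X <-> _]/(is_true `[<I x>]).
exact: sP.
Qed.


(** Eliminate the generators one at a time: the coefficients of the first
    generator that occur in [S] form an ideal, and the rest of [S] lies in the
    span of the other generators. *)
Lemma noetherian_submodule (V : lmodType A) (gs : seq V) (S : V -> Prop) :
    is_submod S -> (forall v, S v -> span gs v) ->
  exists s : seq V, forall v, S v <-> span s v.
Proof.
elim: gs S => [|g gs IH] S hS Sgs; first by exists [::] => v; split=> [/Sgs //|->]; apply: hS.1.
have [S0 SL] := hS; have [_ spL] := span_submod gs.
have [] := @noetherian_span (fun a => exists2 v, S v & span gs (v - a *: g)).
  split; first by exists 0; rewrite // scale0r subr0; apply: (span_submod gs).1.
  move=> a x y [u Su gu] [v Sv gv]; exists (a *: u + v); first exact: SL.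
  suff -> : a *: u + v - (a * x + y) *: g = a *: (u - x *: g) + (v - y *: g) by apply: spL.
  by rewrite scalerBr scalerDl scalerA opprD addrACA.
move=> as_ asP.
have [s' s'P] : exists s : seq V, forall v, S v /\ span gs v <-> span s v.
  apply: IH => [|v []//]; split=> [|a u v [? ?] [? ?]].
    by split=> //; apply: (span_submod gs).1.
  by split; [apply: SL | apply: spL].
have /choice[w wP] (a : A) : exists w, a \in (as_ : seq A) -> S w /\ span gs (w - a *: g).
  have [aas|] := boolP (a \in (as_ : seq A)); last by exists 0.
  by have /asP[w Sw gw] := mem_span (aas : (a : A^o) \in as_); exists w.
exists (map w as_ ++ s') => v; split.
  move=> Sv; have /= [a gsv] := Sgs v Sv.
  have : span as_ (a : A^o) by apply/asP; exists v.
  elim: (as_) wP a v Sv gsv => [|b bs IHb] wP a v Sv gsv /=.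
    move=> a0; apply/s'P; split=> //.
    by move: gsv; rewrite (a0 : a = 0) scale0r subr0.
  move=> [c abs]; exists c.
  have [Sw gw] := wP b (mem_head _ _).
  apply: (IHb _ (a - c * b)) => //.
  - by move=> d ds; apply: wP; rewrite inE ds orbT.
  - by rewrite addrC -scaleNr; apply: SL.
  - suff -> : v - c *: w b - (a - c * b) *: g
       = (- c) *: (w b - b *: g) + (v - a *: g) by apply: spL.
    rewrite scaleNr scalerBr scalerBl scalerA !opprB.
    by rewrite addrACA [RHS]addrACA [v + _]addrC.
apply: span_sub => // h; rewrite mem_cat => /orP[/mapP[a aas ->]|/mem_span/s'P[]//].
by have [] := wP a aas.
Qed.

(** The union of a strictly increasing sequence of ideals would be generated by
    finitely many elements, all of which lie in a single term. *)
Lemma noetherian_max (F : (A -> Prop) -> Prop) I0 :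
    (forall I, F I -> is_ideal I) -> F I0 ->
  exists2 M, F M & forall J, F J -> (forall x, M x -> J x) -> forall x, J x -> M x.
Proof.
move=> Fid FI0; apply: contrapT => nomax.
have step (M : {I | F I}) : exists J : {I | F I},
    (forall x, sval M x -> sval J x) /\ exists2 x, sval J x & ~ sval M x.
  apply: contrapT => nJ; apply: nomax; exists (sval M) => [|J FJ MJ x Jx].
    exact: (svalP M).
  apply: contrapT => nMx; apply: nJ; exists (exist _ J FJ); split=> //.
  by exists x.
have [nxt nxtP] := choice step.
pose C n := sval (iter n nxt (exist _ I0 FI0)).
have C_id n : is_ideal (C n) by apply/Fid/svalP.
have C_mono m n : (m <= n)%N -> forall x, C m x -> C n x.
  move=> /subnK <- x; elim: (n - m)%N => [//|k IH] /IH.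
  by apply: (nxtP _).1.
have U_id : is_ideal (fun x => exists n, C n x).
  split=> [|a x y [m Cx] [n Cy]]; first by exists 0%N; apply: (C_id 0%N).1.
  exists (maxn m n); apply: (C_id _).2; [apply: C_mono Cx|apply: C_mono Cy];
    by rewrite (leq_maxl, leq_maxr).
have [s sP] := noetherian_span U_id.
have [n sn] : exists n, {in s, forall g, C n g}.
  have : {in s, forall g, exists n, C n g} by move=> g /mem_span/sP.
  elim: (s) => [|g r IH] sC; first by exists 0%N.
  have [|m Cm] := IH; first by move=> h hr; apply: sC; rewrite inE hr orbT.
  have [n Cg] := sC g (mem_head _ _).
  exists (maxn m n) => h; rewrite inE => /predU1P[->|/Cm].
    by apply: C_mono Cg; apply: leq_maxr.
  by apply: C_mono; apply: leq_maxl.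
have [_ [x Cx]] := nxtP (iter n nxt (exist _ I0 FI0)); apply.
by apply: (span_sub (V := A^o) (S := C n) (C_id n) sn); apply/sP; exists n.+1.
Qed.

(** An ideal maximal among the counterexamples is prime: if [a * b] is in it
    and [a], [b] are not, then both ideals in the inductive step are larger. *)
Lemma oka_induction (Phi : (A -> Prop) -> Prop) I0 :
    (forall I, is_ideal I -> I 1 -> Phi I) ->
    (forall I a, is_ideal I -> Phi (fun z => exists r, I (z - r * a)) ->
       Phi (fun z => I (a * z)) -> Phi I) ->
    (forall P, is_prime P -> (forall x, I0 x -> P x) -> Phi P) ->
  is_ideal I0 -> Phi I0.
Proof.
move=> Phi1 PhiS PhiP hI0; apply: contrapT => nPhi.
have [||M [hM I0M nM] maxM] := @noetherian_max
  (fun I => [/\ is_ideal I, forall x, I0 x -> I x & ~ Phi I]) I0.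
- by move=> I [].
- by split.
apply: (nM); apply: PhiP => //; split=> // [M1|a b Mab].
  by apply: nM; apply: Phi1.
apply: contrapT => /not_orP[nMa nMb]; apply: nM; apply: (PhiS M a) => //.
  apply: contrapT => nPhi1; apply: nMa.
  apply: (maxM (fun z => exists r, M (z - r * a))).
  - split=> //; first exact: adjoin_is_ideal.
    by move=> x /I0M Mx; exists 0; rewrite mul0r subr0.
  - by move=> x Mx; exists 0; rewrite mul0r subr0.
  - by exists 1; rewrite mul1r subrr; apply: hM.1.
apply: contrapT => nPhi2; apply: nMb.
apply: (maxM (fun z => M (a * z))) => //.
- split=> //; first exact: colon_is_ideal.
  by move=> x /I0M Mx; apply: idealM.
- by move=> x Mx; apply: idealM.
Qed.

Definition fin_quot I := exists s : seq A, forall z, exists2 r, r \in s & I (z - r).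

(** [A / I] is an extension of [A / (I + a A)] by [A / (I : a)]. *)
Lemma fin_quot_of_primes I0 :
    is_ideal I0 -> (forall P, is_prime P -> (forall x, I0 x -> P x) -> fin_quot P) ->
  fin_quot I0.
Proof.
move=> hI0 hP; apply: oka_induction hP hI0 => [I hI I1|I a hI [s sP] [s' s'P]].
  by exists [:: 0] => z; exists 0; rewrite ?inE// -[z - 0]mulr1; apply: idealM.
exists [seq x + y * a | x <- s, y <- s'] => z.
have [x xs [r Ir]] := sP z; have [y ys Iy] := s'P r.
exists (x + y * a); first by apply/allpairsP; exists (x, y).
suff -> : z - (x + y * a) = (z - x - r * a) + a * (r - y) by apply: idealD.
by ring.
Qed.

(** Noetherian form of the existence of a prime ideal that avoids a given
    multiplicative set. *)
Lemma meets_of_primes (S : A -> Prop) I0 :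
    S 1 -> (forall a b, S a -> S b -> S (a * b)) -> is_ideal I0 ->
    (forall P, is_prime P -> (forall x, I0 x -> P x) -> exists2 s, S s & P s) ->
  exists2 s, S s & I0 s.
Proof.
move=> S1 SM hI0 hP; apply: oka_induction hP hI0 => [I hI I1|I a hI [s Ss [r Ir]] [s' Ss' Is']].
  by exists 1.
exists (s * s'); first exact: SM.
suff -> : s * s' = s' * (s - r * a) + r * (a * s') by apply: idealD => //; apply: idealM.
by ring.
Qed.

(** Peel off one factor at a time, replacing [I] by the ideals [(I : a)]. *)
Lemma ideal_powD (m : {pred A}) i j I : is_ideal I ->
    (forall u v, ideal_pow m i u -> ideal_pow m j v -> I (u * v)) ->
  forall z, ideal_pow m (i + j) z -> I z.
Proof.
elim: i I => [|i IH] I hI mI z; first by move=> mz; rewrite -[z]mul1r; apply: mI.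
move=> [s [sP ->]]; rewrite big_seq; apply: big_ind => [|x y|u us].
- exact: hI.1.
- exact: idealD.
have [mu pu] := sP u us.
apply: (IH (fun w => I (u.1 * w))) pu; first exact: colon_is_ideal.
move=> v w pv pw; rewrite mulrA; apply: mI => //.
exists [:: (u.1, v)]; split; last by rewrite big_seq1.
by move=> _ /[1!inE] /eqP->.
Qed.

(** The product of [I + a A] and [(I : a)] lies in [I]. *)
Lemma ideal_pow_sub_of_primes (m : {pred A}) I0 : is_ideal I0 ->
    (forall P, is_prime P -> (forall x, I0 x -> P x) ->
       exists n, forall z, ideal_pow m n z -> P z) ->
  exists n, forall z, ideal_pow m n z -> I0 z.
Proof.
move=> hI0 hP; apply: oka_induction hP hI0 => [I hI I1|I a hI [i iP] [j jP]].
  by exists 0%N => z _; rewrite -[z]mulr1; apply: idealM.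
exists (i + j)%N; apply: ideal_powD => // u v /iP[r Ir] /jP Iv.
suff -> : u * v = v * (u - r * a) + r * (a * v) by apply: idealD => //; apply: idealM.
by ring.
Qed.

End Ideals.

(** Otherwise [0], [P] and [Q] would form a chain of length two. *)
Lemma prime_dim1 (A : idomainType) P Q :
    krull_dim_eq A 1 -> is_prime P -> is_prime Q -> (forall x : A, P x -> Q x) ->
  (exists2 x, P x & x != 0) -> forall x, Q x -> P x.
Proof.
move=> [_ dimA] hP hQ PQ [x Px x0] y Qy; apply: contrapT => nPy.
have h0 : is_prime (fun z : A => z = 0).
  split=> [|/eqP|a b /eqP]; rewrite ?oner_eq0//.
    by split=> // a u v -> ->; rewrite mulr0 addr0.
  by rewrite mulf_eq0 => /orP[]/eqP; [left|right].
pose C (i : 'I_3) : prime_idealr A :=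
  match val i with 0 => prime_pred h0 | 1 => prime_pred hP | _ => prime_pred hQ end.
suff : prime_chain C by move/dimA.
have sub P1 P2 (h1 : is_prime P1) (h2 : is_prime P2) :
    (forall z : A, P1 z -> P2 z) -> (exists2 z, P2 z & ~ P1 z) ->
  {subset prime_pred h1 <= prime_pred h2} /\ ~ {subset prime_pred h2 <= prime_pred h1}.
  move=> s12 [z z2 z1]; split=> [w /asboolP ?|s21]; first by apply/asboolP/s12.
  by apply: z1; apply/asboolP/s21/asboolP.
have P0 z : z = 0 -> P z by move=> ->; have [[]] := hP.
move=> [[|[|[|i]]] hi] [[|[|[|j]]] hj] //= _; apply: sub => //.
- by exists x => //; apply/eqP.
- by move=> z /P0/PQ.
- by exists y => // y0; apply/nPy/P0.
- by exists y.
Qed.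

(** * Submodules as modules *)

Section Submodules.
Variables (A : comNzRingType) (V : lmodType A) (S : V -> Prop).

Definition submod_pred (hS : is_submod S) : {pred V} := fun v => `[< S v >].

Variable hS : is_submod S.
Local Notation SP := (submod_pred hS).

Fact submod_pred_closed : subsemimod_closed SP.
Proof.
case: hS => S0 SL; split=> [|a v /asboolP Sv].
  split; first exact/asboolP.
  by move=> u v /asboolP Su /asboolP Sv; apply/asboolP; rewrite -[u]scale1r; apply: SL.
by apply/asboolP; rewrite -[_ *: _]addr0; apply: SL.
Qed.

Inductive submod : predArgType := Submod v & v \in SP.
Definition submod_val u := let: Submod v _ := u in v.

HB.instance Definition _ := [isSub for submod_val].
HB.instance Definition _ := [Choice of submod by <:].
HB.instance Definition _ :=
  GRing.SubChoice_isSubLmodule.Build A V SP submod submod_pred_closed.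

Lemma submodP (u : submod) : S (val u).
Proof. exact/asboolP/(valP u). Qed.

Lemma submod_lift v : S v -> exists u : submod, val u = v.
Proof. by move=> Sv; exists (Submod (asboolT Sv)). Qed.

Lemma fg_submod (s : seq V) : (forall v, S v <-> span s v) -> fg_module submod.
Proof.
move=> sS; exists (map (insubd (0 : submod)) s) => x.
have /sS/spanP[c xE] := submodP x; rewrite size_map; exists c.
apply: val_inj; rewrite xE linear_sum; apply: eq_bigr => i _.
rewrite linearZ (nth_map 0)//= insubdK//.
by apply/asboolP/sS/mem_span/mem_nth.
Qed.

End Submodules.

Lemma iso_submod (A : comNzRingType) (V : lmodType A) (S S' : V -> Prop)
    (hS : is_submod S) (hS' : is_submod S') :
  (forall v, S v <-> S' v) -> iso_module (submod hS) (submod hS').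
Proof.
move=> SS'; apply: (iso_of_linear_rel (R := fun u v => val u = val v)).
- by move=> a u u' v v' uv uv'; rewrite !linearP/= uv uv'.
- by move=> u; have /SS'/(submod_lift hS')[v] := submodP u; exists v.
- by move=> v; have /SS'/(submod_lift hS)[u] := submodP v; exists u.
- by move=> u u0; apply: val_inj.
- by move=> v v0; apply: val_inj.
Qed.

(** * Rings with a basis over their q-th powers *)

Section FractionModule.
Variable A : idomainType.

Definition frac_scale (a : A) (z : {fraction A}) := a%:F * z.

Fact frac_scaleA a b z : frac_scale a (frac_scale b z) = frac_scale (a * b) z.
Proof. by rewrite /frac_scale tofracM mulrA. Qed.
Fact frac_scale1 : left_id 1 frac_scale.
Proof. by move=> z; rewrite /frac_scale tofrac1 mul1r. Qed.
Fact frac_scaleDr : right_distributive frac_scale +%R.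
Proof. by move=> a x y; rewrite /frac_scale mulrDr. Qed.
Fact frac_scaleDl z : {morph frac_scale^~ z : a b / a + b}.
Proof. by move=> a b; rewrite /frac_scale tofracD mulrDl. Qed.

HB.instance Definition _ := GRing.Zmodule_isLmodule.Build A {fraction A}
  frac_scaleA frac_scale1 frac_scaleDr frac_scaleDl.

Lemma frac_scaleE (a : A) (z : {fraction A}) : a *: z = a%:F * z.
Proof. by []. Qed.

Lemma tofrac_inj : injective (@FracField.tofrac A).
Proof. by move=> a b /eqP; rewrite tofrac_eq => /eqP. Qed.

Lemma frac_repr (z : {fraction A}) : exists a c, c != 0 /\ z = a%:F / c%:F.
Proof.
elim/quotW: z => r; exists \n_r, \d_r; split; first exact: denom_ratioP.
rewrite !piE /FracField.mulf /FracField.invf !numden_Ratio ?oner_eq0 ?denom_ratioP//.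
by rewrite mulr1 mul1r FracField.Ratio_numden.
Qed.

End FractionModule.

Section Frobenius.
Variables (R : comNzRingType) (p : nat) (charR : p \in [pchar R]).

Lemma frobD e (x y : R) : (x + y) ^+ (p ^ e) = x ^+ (p ^ e) + y ^+ (p ^ e).
Proof.
by rewrite exprDn_pchar// pnatX orbC pnatE ?(pcharf_prime charR) ?charR ?orbT.
Qed.

Lemma frob0 e : (0 : R) ^+ (p ^ e) = 0.
Proof. by rewrite expr0n expn_eq0 -leqn0 leqNgt (prime_gt0 (pcharf_prime charR)). Qed.

Lemma frobB e (x y : R) : (x - y) ^+ (p ^ e) = x ^+ (p ^ e) - y ^+ (p ^ e).
Proof. by apply/eqP; rewrite eq_sym subr_eq -frobD subrK. Qed.

End Frobenius.

Lemma seq_pigeonhole (T : eqType) (g : nat -> T) (s : seq T) :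
  (forall i, g i \in s) -> exists i j, [/\ (i < j)%N, (j <= size s)%N & g i = g j].
Proof.
move=> gs; have : ~~ uniq (mkseq g (size s).+1).
  apply/negP => /uniq_leq_size gu; suff /gu : {subset mkseq g (size s).+1 <= s}.
    by rewrite size_mkseq ltnn.
  by move=> _ /mapP[i _ ->].
move/(uniqPn (g 0%N)) => [i [j [ij js gij]]]; rewrite size_mkseq in js.
by exists i, j; split=> //; rewrite !nth_mkseq// in gij; apply: ltn_trans js.
Qed.

Section FrobeniusBasis.
Variables (A : idomainType) (p : nat) (charA : p \in [pchar A]).
Local Notation K := {fraction A}.

Lemma pchar_frac : p \in [pchar K].
Proof. exact: (rmorph_pchar (@FracField.tofrac A)). Qed.

Let frobKD := frobD pchar_frac.
Let frobK0 := frob0 pchar_frac.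

Variables (B : K -> Prop) (t : K).
Hypothesis B_A : forall a, B a%:F.
Hypothesis B_D : forall x y, B x -> B y -> B (x + y).
Hypothesis B_M : forall x y, B x -> B y -> B (x * y).
Hypothesis t_neq0 : t != 0.
Hypothesis B_t : B t.

Let B_0 : B 0. Proof. by rewrite -tofrac0. Qed.
Let B_N x : B x -> B (- x).
Proof. by move=> Bx; rewrite -mulN1r -tofrac1 -tofracN; apply: B_M. Qed.
Let B_X x n : B x -> B (x ^+ n).
Proof.
by move=> Bx; elim: n => [|n IH]; rewrite ?expr0 -?tofrac1// exprS; apply: B_M.
Qed.
Let B_sum n (f : nat -> K) : (forall i, (i < n)%N -> B (f i)) -> B (\sum_(i < n) f i).
Proof. by move=> Bf; apply: big_ind => // i _; apply: Bf. Qed.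

(** The value at [f] of the map [B^q -> B] attached to the candidate basis
    [1, t, ..., t^(q-1)] of [B] over its subring of [q]-th powers. *)
Definition frob_comb e (f : nat -> K) := \sum_(i < p ^ e) t ^+ i * f i ^+ (p ^ e).

Lemma frob_comb_linear e a f g :
  frob_comb e (fun i => a * f i + g i) = a ^+ (p ^ e) * frob_comb e f + frob_comb e g.
Proof.
rewrite /frob_comb mulr_sumr -big_split; apply: eq_bigr => i _ /=.
by rewrite frobKD exprMn mulrDr mulrCA.
Qed.

Lemma eq_frob_comb e f g :
  (forall i, (i < p ^ e)%N -> f i = g i) -> frob_comb e f = frob_comb e g.
Proof. by move=> fg; apply: eq_bigr => i _; rewrite fg. Qed.

Lemma frob_comb0 e : frob_comb e (fun=> 0) = 0.
Proof. by apply: big1 => i _; rewrite frobK0 mulr0. Qed.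

Definition tdiv n x := exists2 b, B b & x = t ^+ n * b.

Lemma tdivD n x y : tdiv n x -> tdiv n y -> tdiv n (x + y).
Proof. by move=> [b Bb ->] [c Bc ->]; exists (b + c); rewrite ?mulrDr//; apply: B_D. Qed.

Lemma tdivN n x : tdiv n x -> tdiv n (- x).
Proof. by move=> [b Bb ->]; exists (- b); rewrite ?mulrN//; apply: B_N. Qed.

Lemma tdivB n x y : tdiv n x -> tdiv n y -> tdiv n (x - y).
Proof. by move=> hx hy; apply/tdivD => //; apply: tdivN. Qed.

Lemma tdivMr n x b : tdiv n x -> B b -> tdiv n (b * x).
Proof. by move=> [c Bc ->] Bb; exists (b * c); rewrite 1?mulrCA//; apply: B_M. Qed.

Lemma tdivW m n x : (m <= n)%N -> tdiv n x -> tdiv m x.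
Proof.
move=> mn [b Bb ->]; exists (t ^+ (n - m) * b); first by apply: B_M => //; apply: B_X.
by rewrite mulrA -exprD subnKC.
Qed.

Lemma tdiv_expr n b : B b -> tdiv n (t ^+ n * b).
Proof. by exists b. Qed.

Lemma tdiv_mul n x : tdiv n.+1 (t * x) -> tdiv n x.
Proof. by move=> [b Bb]; rewrite exprS -mulrA => /(mulfI t_neq0) ->; exists b. Qed.

(** The first coefficient is divisible by [t] because all the other terms are;
    then it is negligible, and the remaining terms can be divided by [t]. *)
Lemma tdiv_coefs n (c : nat -> K) :
    (forall i, B (c i)) -> (forall i, tdiv 1 (c i) -> tdiv n (c i)) ->
    tdiv n (\sum_(i < n) t ^+ i * c i) ->
  forall i, (i < n)%N -> tdiv 1 (c i).
Proof.
elim: n c => [//|n IH] c Bc cn; rewrite big_ord_recl expr0 mul1r.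
set s := \sum_(i < n) t ^+ i * c i.+1.
rewrite (eq_bigr (fun i : 'I_n => t * (t ^+ i * c i.+1))) => [|i _]; last first.
  by rewrite mulrA -exprS.
rewrite -mulr_sumr -/s => c_s.
have Bs : B s by apply: (B_sum (f := fun i => t ^+ i * c i.+1)) => i _; apply: B_M; first exact: B_X.
have c0 : tdiv 1 (c 0%N).
  rewrite -[c 0%N](addrK (t * s)); apply: tdivB; first exact: tdivW c_s.
  by exists s; rewrite ?expr1.
have s_n : tdiv n s.
  apply: tdiv_mul; rewrite -[t * s](addKr (c 0%N)) addrC.
  by apply: tdivB c_s _; apply: cn.
move=> [//|i]; rewrite ltnS; apply: (IH (fun i => c i.+1)) => // j /cn.
by apply: tdivW.
Qed.

(** A vanishing combination has all its coefficients divisible by [t]; dividing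
    them by [t] yields another one. *)
Lemma frob_comb_inj e f :
    (forall b, B b -> tdiv 1 (b ^+ (p ^ e)) -> tdiv 1 b) ->
    (forall b, (forall n, tdiv n b) -> b = 0) ->
    (forall i, B (f i)) -> frob_comb e f = 0 ->
  forall i, (i < p ^ e)%N -> f i = 0.
Proof.
move=> tred tsep Bf comb0 i iq; apply: tsep => n.
elim: n f Bf comb0 => [|n IH] f Bf comb0; first by exists (f i); rewrite ?mul1r.
have ft j : (j < p ^ e)%N -> tdiv 1 (f j).
  move=> jq; apply: (tred) => //; move: j jq.
  apply: (tdiv_coefs (c := fun i => f i ^+ (p ^ e))) => [j|j|]; first exact: B_X.
    case/tred => // b Bb ->; exists (b ^+ (p ^ e)); first exact: B_X.
    by rewrite exprMn expr1.
  by rewrite -/(frob_comb e f) comb0; exists 0; rewrite ?mulr0.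
have /choice[g gP] j : exists b, B b /\ ((j < p ^ e)%N -> f j = t * b).
  by have [/ft[b Bb ->]|_] := ltnP j (p ^ e); [exists b | exists 0].
have [] // := IH g; first by move=> j; have [] := gP j.
  apply: (mulfI (expf_neq0 (p ^ e) t_neq0)); rewrite mulr0 -comb0.
  rewrite -[LHS]addr0 -(frob_comb0 e) -frob_comb_linear.
  by apply: eq_frob_comb => j jq; rewrite addr0 (gP j).2.
by move=> b Bb gib; exists b => //; rewrite (gP i).2// gib exprS mulrA.
Qed.

(** In the finite ring [B / t] the sequence [b, b^q, b^(q^2), ...] repeats
    itself, and raising to the power [q] is injective there. *)
Lemma residue_frob_surj (F : seq K) :
    (forall b, B b -> exists2 r, r \in F & tdiv 1 (b - r)) ->
    (forall e b, B b -> tdiv 1 (b ^+ (p ^ e)) -> tdiv 1 b) ->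
  forall e b, B b -> exists2 r, B r & tdiv 1 (b - r ^+ (p ^ e)).
Proof.
move=> Fres tred e b Bb.
have /choice[g gP] i : exists r, r \in F /\ tdiv 1 (b ^+ (p ^ (e * i)) - r).
  by have [|r rF br] := Fres (b ^+ (p ^ (e * i))); [exact: B_X | exists r].
have [|i [j [ij _ gij]]] := @seq_pigeonhole _ g F; first by move=> i; have [] := gP i.
(* [b^(q^i)] and [b^(q^j)] are congruent, hence so are [b] and [b^(q^(j - i))]. *)
exists (b ^+ (p ^ (e * (j - i).-1))); first exact: B_X.
have -> : (b ^+ (p ^ (e * (j - i).-1))) ^+ (p ^ e) = b ^+ (p ^ (e * (j - i))).
  by rewrite -exprM -expnD -mulnSr prednK ?subn_gt0.
apply: (tred (e * i)%N).
  by apply: B_D => //; apply: B_N; apply: B_X.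
rewrite (frobB pchar_frac) -exprM -expnD -mulnDr subnK; last exact: ltnW.
have [_ bi] := gP i; have [_ bj] := gP j.
have := tdivB bi bj; rewrite gij; congr tdiv; ring.
Qed.

(** Successive approximation: peel off the [q] lowest coefficients, divide by
    [t ^ q] and start again; the digits of each coordinate sum to a limit. *)
Lemma frob_gen_of_complete e :
    (forall r : nat -> K, (forall j, B (r j)) ->
       exists2 b, B b & forall n, tdiv n (b - \sum_(j < n) t ^+ j * r j)) ->
    (forall b, (forall n, tdiv n b) -> b = 0) ->
    (forall b, B b -> exists2 r, B r & tdiv 1 (b - r ^+ (p ^ e))) ->
  forall b, B b -> exists2 f : nat -> K, forall i, B (f i) & b = frob_comb e f.
Proof.
move=> tcomp tsep tperf b0 Bb0.
have peel n b : B b -> exists rb : (nat -> K) * K,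
    [/\ forall i, B (rb.1 i), B rb.2 &
        b = \sum_(i < n) t ^+ i * rb.1 i ^+ (p ^ e) + t ^+ n * rb.2].
  move=> Bb; elim: n => [|n [[r b'] [/= Br Bb' bE]]].
    by exists (fun=> 0, b); split=> //=; rewrite big_ord0 add0r mul1r.
  have [s Bs [b'' Bb'' b'E]] := tperf b' Bb'.
  exists (fun i => if i == n then s else r i, b''); split=> //= [i|]; first by case: ifP.
  rewrite big_ord_recr/= eqxx bE -[b'](subrK (s ^+ (p ^ e))) b'E expr1 -addrA.
  congr (_ + _); last by rewrite exprSr; ring.
  by apply: eq_bigr => i _; rewrite ltn_eqF.
have /choice[h hP] b : exists rb : (nat -> K) * K, B b ->
    [/\ forall i, B (rb.1 i), B rb.2 & b = frob_comb e rb.1 + t ^+ (p ^ e) * rb.2].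
  have [/(peel (p ^ e)%N)[rb ?]|nB] := pselect (B b); first by exists rb.
  by exists (fun=> 0, 0).
pose b n := iter n (fun b => (h b).2) b0.
have Bb n : B (b n) by elim: n => [//|n /hP[]].
pose d n := (h (b n)).1.
have Bd n i : B (d n i) by have [Bh _ _] := hP _ (Bb n); apply: Bh.
pose s n i := \sum_(j < n) t ^+ j * d j i.
have sE n : b0 = frob_comb e (s n) + t ^+ n ^+ (p ^ e) * b n.
  elim: n => [|n ->].
    rewrite expr0 expr1n mul1r (@eq_frob_comb e _ (fun=> 0)) ?frob_comb0 ?add0r// => i _.
    by rewrite /s big_ord0.
  rewrite (@eq_frob_comb e (s n.+1) (fun i => t ^+ n * d n i + s n i)); last first.
    by move=> i _; rewrite /s big_ord_recr addrC.
  have [_ _ bE] := hP _ (Bb n).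
  rewrite [in LHS]bE frob_comb_linear exprS exprMn -/(d n) -[(h (b n)).2]/(b n.+1).
  by move: (t ^+ n ^+ _) (t ^+ (p ^ e)) => u v; ring.
have /choice[f fP] i : exists x, B x /\ forall n, tdiv n (x - s n i).
  by have [x Bx xP] := tcomp (d^~ i) (Bd^~ i); exists x.
exists f => [i|]; first by have [] := fP i.
apply/subr0_eq/tsep => n; have /choice[g gP] i : exists g, B g /\ f i = t ^+ n * g + s n i.
  have [_ /(_ n)[g Bg fE]] := fP i; exists g; split=> //.
  by rewrite -fE subrK.
have -> : b0 - frob_comb e f = t ^+ n * (t ^+ n ^+ (p ^ e).-1 * (b n - frob_comb e g)).
  rewrite (@eq_frob_comb e f (fun i => t ^+ n * g i + s n i)); last first.
    by move=> i _; have [] := gP i.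
  rewrite frob_comb_linear {1}(sE n) mulrA -exprS prednK; first by ring.
  by rewrite expn_gt0 (prime_gt0 (pcharf_prime charA)).
apply: tdiv_expr; apply: B_M; first by rewrite -exprM; apply: B_X.
apply: B_D => //; apply: B_N.
apply: (B_sum (f := fun i => t ^+ i * g i ^+ (p ^ e))) => i _.
by apply: B_M; [apply: B_X | apply: B_X; have [] := gP i].
Qed.

Variable c : nat.
Hypothesis t_conductor : forall x, tdiv c x -> exists a, x = a%:F.

Definition extend n (b : {ffun 'I_n -> K}) (i : nat) : K := oapp b 0 (insub i).

Lemma extend_ord n (b : {ffun 'I_n -> K}) (i : 'I_n) : extend b i = b i.
Proof. by rewrite /extend valK. Qed.

Lemma extend_out n (b : {ffun 'I_n -> K}) i : (n <= i)%N -> extend b i = 0.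
Proof. by rewrite /extend leqNgt => ni; rewrite insubN. Qed.

Lemma extend_linear n (a : A) (b b' : {ffun 'I_n -> K}) i :
  extend (a *: b + b') i = a%:F * extend b i + extend b' i.
Proof.
have [i_n|n_i] := ltnP i n; last by rewrite !extend_out// mulr0 addr0.
by rewrite !(extend_ord _ (Ordinal i_n)) !ffunE.
Qed.

Lemma B_extend n (b : {ffun 'I_n -> K}) i : (forall k, B (b k)) -> B (extend b i).
Proof.
move=> Bb; have [i_n|n_i] := ltnP i n; last by rewrite extend_out.
by rewrite (extend_ord _ (Ordinal i_n)).
Qed.

(** Coordinates beyond the conductor exponent [c] are unconstrained, so the
    condition that a combination lies in [A] concerns the first [c] ones. When
    [p ^ e < c] only [p ^ e] of these occur, and the others are set to zero. *)
Definition remainder e (b : {ffun 'I_c -> K}) :=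
  [/\ forall i, B (b i), forall i : 'I_c, (p ^ e <= i)%N -> b i = 0 &
      exists a, frob_comb e (extend b) = a%:F].

Lemma frob_comb_extend_linear e (a : A) n (b b' : {ffun 'I_n -> K}) :
  frob_comb e (extend (a *: b + b')) =
  (a ^+ (p ^ e))%:F * frob_comb e (extend b) + frob_comb e (extend b').
Proof.
rewrite tofracXn -frob_comb_linear.
by apply: eq_frob_comb => i _; apply: extend_linear.
Qed.

Lemma remainder_submod e : is_submod (remainder e).
Proof.
split.
  split=> [i|i|]; rewrite ?ffunE//; exists 0; rewrite tofrac0 -(frob_comb0 e).
  apply: eq_frob_comb => i _; have [ic|] := ltnP i c; last exact: extend_out.
  by rewrite (extend_ord _ (Ordinal ic)) ffunE.
move=> a u v [Bu u0 [x ux]] [Bv v0 [y vy]]; split=> [i|i qi|].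
- by rewrite !ffunE; apply: B_D => //; apply: B_M.
- by rewrite !ffunE u0// v0// scaler0 addr0.
- exists (a ^+ (p ^ e) * x + y).
  by rewrite frob_comb_extend_linear ux vy tofracD tofracM.
Qed.

Lemma B_submod : is_submod B.
Proof. by split=> // a u v Bu Bv; apply: B_D => //; apply: B_M. Qed.

Definition B_mod : lmodType A := submod B_submod.
Definition remainder_mod e : lmodType A := submod (remainder_submod e).

Hypothesis noethA : noetherian A.

Let B_frac b : B b -> exists a : A, b = a *: t ^- c.
Proof.
move=> Bb; have [a ba] := t_conductor (tdiv_expr c Bb); exists a.
by rewrite frac_scaleE -ba mulrAC divff ?mul1r// expf_neq0.
Qed.

Lemma B_mod_fg : fg_module B_mod.
Proof.
have [|s sP] := noetherian_submodule noethA (gs := [:: t ^- c]) B_submod.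
  by move=> b /B_frac[a ->]; exists a; rewrite subrr.
exact: fg_submod sP.
Qed.

(** The submodule lies in [B ^ c], which is contained in the finitely generated
    module [(t ^- c * A) ^ c]. *)
Lemma remainder_mod_fg e : fg_module (remainder_mod e).
Proof.
pose d i : {ffun 'I_c -> K} := [ffun j => if j == i then t ^- c else 0].
have [|s sP] := noetherian_submodule noethA
    (gs := [seq d i | i <- enum 'I_c]) (remainder_submod e).
  move=> b [Bb _ _]; have /choice[a aE] i := B_frac (Bb i).
  have -> : b = \sum_i a i *: d i.
    apply/ffunP=> j; rewrite aE sum_ffunE (bigD1 j)//= !ffunE eqxx big1 ?addr0// => i ij.
    by rewrite !ffunE eq_sym (negPf ij) scaler0.
  have [sp0 spL] := span_submod [seq d i | i <- enum 'I_c].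
  apply: big_ind => // [u v su sv|i _]; first by rewrite -[u]scale1r; apply: spL.
  rewrite -[_ *: _]addr0; apply: spL => //.
  by apply/mem_span/map_f; rewrite mem_enum.
exact: fg_submod sP.
Qed.

Variable F : seq K.
Hypothesis F_residues : forall b, B b -> exists2 r, r \in F & tdiv 1 (b - r).
Hypothesis frob_gen : forall e b, B b ->
  exists2 f : nat -> K, forall i, B (f i) & b = frob_comb e f.
Hypothesis t_reduced : forall e b, B b -> tdiv 1 (b ^+ (p ^ e)) -> tdiv 1 b.
Hypothesis t_separated : forall b, (forall n, tdiv n b) -> b = 0.

Definition residue_vector (r : {ffun 'I_c -> 'I_(size F)}) : {ffun 'I_c -> K} :=
  [ffun i => F`_(r i)].

(** As [p ^ e >= c], congruence modulo [t] does not affect membership: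
    [q]-th powers of multiples of [t] are multiples of [t ^ c]. *)
Lemma remainder_congr e (b b' : {ffun 'I_c -> K}) : (c <= e)%N -> (forall i, tdiv 1 (b' i - b i)) ->
  remainder e b -> remainder e b'.
Proof.
move=> ce bb' [Bb b0 [a ba]].
have c_q : (c <= p ^ e)%N.
  by rewrite (leq_trans ce)// ltnW// ltn_expl// (prime_gt1 (pcharf_prime charA)).
have B_d i : B (b' i - b i).
  by have [d Bd ->] := bb' i; rewrite expr1; apply: B_M.
split=> [i|i /(leq_trans c_q)|]; first by rewrite -[b' i](subrK (b i)); apply: B_D.
  by rewrite leqNgt ltn_ord.
have [|a' a'E] := @t_conductor (frob_comb e (extend (b' - b))).
  apply: big_ind => [|x y|i _].
  - by exists 0; rewrite ?mulr0.
  - exact: tdivD.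
  - apply: tdivMr; last exact: B_X.
    have [ic|ci] := ltnP i c; last first.
      by rewrite extend_out// frobK0; exists 0; rewrite ?mulr0.
    rewrite (extend_ord _ (Ordinal ic)) !ffunE.
    have [d Bd ->] := bb' (Ordinal ic).
    rewrite exprMn expr1; apply: (@tdivW c (p ^ e)) => //; apply: tdiv_expr.
    exact: B_X.
exists (a' + a); rewrite tofracD -a'E -ba -[b'](subrK b) -[b' - b]scale1r.
by rewrite frob_comb_extend_linear expr1n tofrac1 mul1r scale1r addrK.
Qed.

(** The second component separates the finitely many [e < c], to which
    [remainder_congr] does not apply. *)
Definition remainder_invariant e : {set {ffun 'I_c -> 'I_(size F)}} * 'I_c.+1 :=
  ([set r | `[< remainder e (residue_vector r) >]], inord (minn e c)).

Lemma remainder_invariantP e e' : remainder_invariant e = remainder_invariant e' ->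
  iso_module (remainder_mod e) (remainder_mod e').
Proof.
move=> [eqW /(congr1 val)/=]; rewrite !inordK ?ltnS ?geq_minr// => eq_min.
have [<-|ee'] := eqVneq e e'; first exact: iso_module_refl.
have [ce ce'] : (c <= e /\ c <= e')%N by lia.
apply: iso_submod.
suff imp e1 e2 (c1 : (c <= e1)%N) (c2 : (c <= e2)%N) b :
    [set r | `[< remainder e1 (residue_vector r) >]] =
    [set r | `[< remainder e2 (residue_vector r) >]] ->
    remainder e1 b -> remainder e2 b.
  by move=> b; split; apply: imp.
move=> /setP eqW12 rb; have [Bb _ _] := rb.
have /choice[r rP] i : exists k : 'I_(size F), tdiv 1 (b i - F`_k).
  have [x xF bx] := F_residues (Bb i).
  have xs : (index x F < size F)%N by rewrite index_mem.
  by exists (Ordinal xs); rewrite /= nth_index.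
have := eqW12 (finfun r); rewrite !inE => r12.
apply: (@remainder_congr e2 (residue_vector (finfun r))) => //.
  by move=> i; rewrite !ffunE.
apply/asboolP; rewrite -r12; apply/asboolP.
apply: (@remainder_congr e1 b) => // i.
by rewrite !ffunE -opprB; apply: tdivN.
Qed.

(** The coordinates with respect to [1, t, ..., t^(q-1)] assembled from those in
    the remainder, which come first, and those in the free part. *)
Definition glue n (u : {ffun 'I_n -> B_mod} * {ffun 'I_c -> K}) (i : nat) : K :=
  extend u.2 i + (if (c <= i)%N then extend [ffun j => val (u.1 j)] (i - c) else 0).

Lemma frob_comb_glue e n u : exists a,
  frob_comb e (@glue n u) = frob_comb e (extend u.2) + a%:F.
Proof.
pose tail i := if (c <= i)%N then extend [ffun j => val (u.1 j)] (i - c) else 0.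
have B_tail i : B (tail i).
  rewrite /tail; case: ifP => // _; apply: B_extend => j.
  by rewrite ffunE; apply: submodP.
have [|a aE] := @t_conductor (frob_comb e tail).
  apply: big_ind => [|x y|i _]; [by exists 0; rewrite ?mulr0 | exact: tdivD |].
  have [ci|ic] := leqP c i; last by rewrite /tail leqNgt ic frobK0; exists 0; rewrite ?mulr0.
  rewrite -(subnKC ci) exprD -mulrA; apply: tdiv_expr.
  by apply: B_M; apply: B_X; rewrite // /tail ifT.
exists a; rewrite -aE addrC -[frob_comb e tail]mul1r -(expr1n _ (p ^ e)).
rewrite -frob_comb_linear; apply: eq_frob_comb => i _.
by rewrite mul1r addrC.
Qed.

(** An element corresponds to the family of its coordinates. When [q < c] there
    is no free part, and [remainder] forces the superfluous coordinates to be
    zero. *)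
Lemma frob_mod_decomposition e : exists n,
  iso_module (frob_mod charA e A^o) ({ffun 'I_n -> B_mod} * remainder_mod e)%type.
Proof.
pose n := (p ^ e - c)%N; exists n.
pose gl (v : ({ffun 'I_n -> B_mod} * remainder_mod e)%type) := glue (v.1, val v.2).
have B_gl v i : B (gl v i).
  apply: B_D; first by have [Bb _ _] := submodP v.2; apply: B_extend.
  case: ifP => // _; apply: B_extend => j; rewrite ffunE; exact: submodP.
apply: (iso_of_linear_rel (U := frob_mod charA e A^o)
  (R := fun u v => (u : A)%:F = frob_comb e (gl v))).
- move=> a u u' v v' uE u'E.
  transitivity ((a ^+ (p ^ e))%:F * (u : A)%:F + (u' : A)%:F).
    by rewrite -tofracM -tofracD.
  rewrite uE u'E tofracXn -frob_comb_linear.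
  apply: eq_frob_comb => i _; rewrite /gl /glue.
  have -> : val (a *: v + v').2 = a *: val v.2 + val v'.2 by exact: linearP.
  have -> : [ffun j => val ((a *: v + v').1 j)] =
      a *: [ffun j => val (v.1 j)] + [ffun j => val (v'.1 j)] :> {ffun 'I_n -> K}.
    by apply/ffunP=> j; rewrite !ffunE; exact: linearP.
  rewrite !extend_linear mulrDr addrACA; congr (_ + _).
  by case: ifP => _; rewrite ?mulr0 ?addr0.
- move=> u; have [f Bf uE] := frob_gen e (B_A u).
  pose b : {ffun 'I_c -> K} := [ffun i : 'I_c => if (i < p ^ e)%N then f i else 0].
  have /choice[g gE] (j : 'I_n) : exists x : B_mod, val x = f (c + j)%N.
    by have [x xE] := submod_lift B_submod (Bf (c + j)%N); exists x.
  have glE : frob_comb e f = frob_comb e (glue (finfun g, b)).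
    apply: eq_frob_comb => i iq; rewrite /glue/=; have [ci|ic] := leqP c i; last first.
      by rewrite (extend_ord _ (Ordinal ic)) ffunE/= iq addr0.
    have i_n : (i - c < n)%N by rewrite ltn_sub2r// (leq_ltn_trans ci).
    rewrite extend_out// add0r (extend_ord _ (Ordinal i_n)) !ffunE gE.
    by rewrite /= subnKC.
  have [a aE] := frob_comb_glue e (finfun g, b).
  have [w wE] : exists w : remainder_mod e, val w = b.
    apply: submod_lift; split=> [i|i qi|]; rewrite ?ffunE.
    - by case: ifP.
    - by rewrite ltnNge qi.
    - exists ((u : A) - a); apply/esym/eqP.
      by rewrite tofracB subr_eq -aE -glE; apply/eqP.
  by exists (finfun g, w); rewrite /gl wE -glE.
- move=> v; have [a aE] := frob_comb_glue e (v.1, val v.2).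
  have [_ _ [a' a'E]] := submodP v.2.
  by exists (a' + a); rewrite /gl aE tofracD -a'E.
- move=> u /= uE; apply: (@tofrac_inj A); apply: etrans uE (etrans _ (esym (tofrac0 A))).
  rewrite -(frob_comb0 e).
  apply: eq_frob_comb => i _; rewrite /gl /glue /extend.
  case: insub => [j|]/=; rewrite ?ffunE add0r; case: ifP => // _;
    by case: insub => [j'|]//=; rewrite !ffunE.
- move=> [g w] /= /esym v0; have {}v0 := etrans v0 (tofrac0 A).
  have gl0 : forall i, (i < p ^ e)%N -> gl (g, w) i = 0.
    by apply: (frob_comb_inj (e := e)) => //; apply: t_reduced.
  have [_ w0 _] := submodP w; congr pair.
    apply/ffunP=> j; apply: val_inj; rewrite ffunE.
    have jq : (c + j < p ^ e)%N by have := ltn_ord j; rewrite /n; lia.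
    have := gl0 _ jq; rewrite /gl /glue extend_out ?leq_addr// add0r addKn.
    by rewrite extend_ord ffunE.
  apply: val_inj; apply/ffunP=> i; rewrite ffunE; have [iq|/w0//] := ltnP i (p ^ e).
  by have := gl0 _ iq; rewrite /gl /glue leqNgt ltn_ord addr0 extend_ord.
Qed.

Theorem ffrt_of_frobenius_parameter : finite_F_representation_type charA.
Proof.
exact: (ffrt_of_finite_remainders B_mod_fg remainder_mod_fg remainder_invariantP
  frob_mod_decomposition).
Qed.

End FrobeniusBasis.

(** * The index of a principal ideal *)

Lemma rat_pow_unbounded (r M : rat) : 1 < r -> exists n, forall m, (n <= m)%N -> M < r ^+ m.
Proof.
move=> r1; have r1_gt0 : 0 < r - 1 by rewrite subr_gt0.
have bern n : 1 + n%:R * (r - 1) <= r ^+ n.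
  elim: n => [|n IH]; first by rewrite mul0r addr0.
  rewrite exprS -natr1; apply: le_trans (_ : r * (1 + n%:R * (r - 1)) <= _).
    rewrite -subr_ge0 (_ : _ - _ = n%:R * (r - 1) ^+ 2); last by ring.
    by rewrite mulr_ge0 ?ler0n ?sqr_ge0.
  by rewrite ler_pM2l// (lt_trans ltr01).
exists (Num.bound (`|M| / (r - 1))) => m hm.
apply: lt_le_trans (bern m); apply: le_lt_trans (ler_norm M) _.
rewrite -[`|M|]add0r ltrD// -ltr_pdivrMr//.
apply: lt_le_trans (_ : (Num.bound (`|M| / (r - 1)))%:R <= _); last by rewrite ler_nat.
by apply: archi_boundP; rewrite divr_ge0// ltW.
Qed.

Lemma rat_pow_small (r eps : rat) : 0 <= r < 1 -> 0 < eps ->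
  exists n, forall m, (n <= m)%N -> r ^+ m < eps.
Proof.
move=> /andP[r0 r1] eps0; move: r0; rewrite le_eqVlt => /predU1P[<-|r0].
  by exists 1%N => m m0; rewrite expr0n gtn_eqF.
have [|n nP] := @rat_pow_unbounded r^-1 eps^-1; first by rewrite invf_gt1.
exists n => m /nP; rewrite exprVn ltf_pV2// posrE//; exact: exprn_gt0.
Qed.

Section Index.
Variable A : idomainType.
Implicit Types a b c x y z : A.

Definition dvr c z := exists w, z = w * c.

Lemma dvr_ideal c : is_ideal (dvr c). Proof. exact: principal_is_ideal. Qed.

Lemma dvrB c x y : dvr c x -> dvr c y -> dvr c (x - y).
Proof. by apply: idealB; apply: dvr_ideal. Qed.

Lemma dvrD c x y : dvr c x -> dvr c y -> dvr c (x + y).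
Proof. by apply: idealD; apply: dvr_ideal. Qed.

Lemma dvrr c : dvr c c. Proof. by exists 1; rewrite mul1r. Qed.
Lemma dvr0 c : dvr c 0. Proof. by exists 0; rewrite mul0r. Qed.

Lemma dvr_mull c a x : dvr c x -> dvr c (a * x).
Proof. by move=> h; apply: idealM (dvr_ideal c) h. Qed.

Lemma dvr_trans b a c : dvr a b -> dvr b c -> dvr a c.
Proof. by move=> [u ->] [v ->]; exists (v * u); rewrite mulrA. Qed.

Lemma dvr_exp c m n : (m <= n)%N -> dvr (c ^+ m) (c ^+ n).
Proof. by move=> mn; exists (c ^+ (n - m)); rewrite -exprD subnK. Qed.

Lemma dvr_pmul2 c a b : c != 0 -> dvr (a * c) (b * c) -> dvr a b.
Proof. by move=> c0 [w]; rewrite mulrA => /(mulIf c0) ->; exists w. Qed.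

Definition residues c n := exists2 s : seq A, size s = n &
  [/\ uniq s, forall z, exists2 r, r \in s & dvr c (z - r)
    & {in s &, forall r r', dvr c (r - r') -> r = r'}].

(** A finite list of representatives becomes irredundant by dropping those that
    are congruent to a later one. *)
Lemma residues_exist c : fin_quot (dvr c) -> exists n, residues c n.
Proof.
move=> [s sP].
suff [s' [us s'P sep]] : exists s', [/\ uniq s',
    {in s, forall z, exists2 r, r \in s' & dvr c (z - r)}
    & {in s' &, forall r r', dvr c (r - r') -> r = r'}].
  exists (size s'), s' => //; split=> // z.
  have [r /s'P[r' r's' d'] d] := sP z; exists r' => //.
  by rewrite -[z](subrK r) -addrA; apply: dvrD.
elim: s {sP} => [|z s [s' [us s'P sep]]]; first by exists [::].
have [[r rs' zr]|nz] := pselect (exists2 r, r \in s' & dvr c (z - r)).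
  exists s'; split=> // w; rewrite inE => /predU1P[->|/s'P//].
  by exists r.
exists (z :: s'); split.
- rewrite /= us andbT; apply/negP => zs'; apply: nz; exists z => //.
  by rewrite subrr; apply: dvr0.
- move=> w; rewrite inE => /predU1P[->|/s'P[r rs' wr]].
    by exists z; rewrite ?mem_head// subrr; apply: dvr0.
  by exists r; rewrite // inE rs' orbT.
- move=> r r'; rewrite !inE => /predU1P[->|rs'] /predU1P[->|r's'] // d.
  + by case: nz; exists r'.
  + case: nz; exists r => //; rewrite -opprB -mulN1r; exact: dvr_mull.
  + exact: sep.
Qed.

Lemma residues_unique c m n : residues c m -> residues c n -> m = n.
Proof.
have le k l : residues c k -> residues c l -> (k <= l)%N.
  move=> [s <- [us _ sep]] [s' <- [_ s'P _]].
  have /choice[f fP] z : exists r, r \in s' /\ dvr c (z - r).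
    by have [r] := s'P z; exists r.
  rewrite -(size_map f s); apply: uniq_leq_size.
    rewrite map_inj_in_uniq// => x y xs ys fxy; apply: sep => //.
    have [_ dx] := fP x; have [_ dy] := fP y.
    have := dvrB dx dy; rewrite fxy; congr dvr; ring.
  by move=> _ /mapP[x _ ->]; have [] := fP x.
by move=> hm hn; apply/eqP; rewrite eqn_leq !le.
Qed.

(** [A / a b A] is an extension of [A / a A] by [a A / a b A], which is
    isomorphic to [A / b A] because [a] is not a zero divisor. *)
Lemma residuesM a b m n : a != 0 -> residues a m -> residues b n ->
  residues (a * b) (m * n).
Proof.
move=> a0 [s <- [us sP sep]] [s' <- [us' s'P sep']].
have inj : {in s, forall x, {in s', forall y, {in s, forall x', {in s', forall y',
    dvr (a * b) (x + a * y - (x' + a * y')) -> x = x' /\ y = y'}}}}.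
  move=> x xs y ys x' x's y' y's [w wE].
  have xx' : x = x'.
    apply: sep => //; exists (w * b - y + y').
    transitivity ((x + a * y - (x' + a * y')) - a * (y - y')); first by ring.
    by rewrite wE; ring.
  split=> //; apply: sep' => //; apply: (dvr_pmul2 a0); exists w.
  by rewrite xx' [a * b]mulrC in wE; rewrite -wE; ring.
exists [seq x + a * y | x <- s, y <- s']; first by rewrite size_allpairs.
split.
- apply: allpairs_uniq => // -[x y] [x' y'] /allpairsP[[u v] [/= us_ vs [-> ->]]].
  move=> /allpairsP[[u' v'] [/= us_' vs' [-> ->]]] /= e.
  have [] := inj u us_ v vs u' us_' v' vs'; last by move=> -> ->.
  by rewrite e subrr; apply: dvr0.
- move=> z; have [x xs [w zE]] := sP z; have [y ys [v wE]] := s'P w.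
  exists (x + a * y); first by apply/allpairsP; exists (x, y).
  exists v; transitivity ((z - x) - a * y); first by ring.
  by rewrite zE -[w](subrK y) wE; ring.
- move=> _ _ /allpairsP[[x y] [/= xs ys ->]] /allpairsP[[x' y'] [/= xs' ys' ->]].
  by move/(inj x xs y ys x' xs' y' ys') => [-> ->].
Qed.

End Index.

(** * The absolute value of a complete one-dimensional domain *)

Definition infinitely_often (P : nat -> Prop) := forall m, exists2 n, (m <= n)%N & P n.

Lemma infinitely_often_pigeonhole (T : eqType) (s : seq T) (P : nat -> Prop)
    (Q : nat -> T -> Prop) :
    (forall n, P n -> exists2 r, r \in s & Q n r) -> infinitely_often P ->
  exists r, infinitely_often (Q^~ r).
Proof.
move=> PQ infP; apply: contrapT => nQ.
have /choice[m mP] r : exists m, forall n, (m <= n)%N -> ~ Q n r.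
  apply: contrapT => nm; apply: nQ; exists r => m; apply: contrapT => nn.
  by apply: nm; exists m => n mn Qn; apply: nn; exists n.
have [n mn /PQ[r rs Qnr]] := infP (\max_(r <- s) m r)%N.
apply: mP Qnr; apply: leq_trans mn; exact: leq_bigmax_seq.
Qed.

Section CompleteDomain.
Variables (A : idomainType) (x : A).
Hypothesis x_neq0 : x != 0.
Hypothesis fin_quotA : forall c : A, c != 0 -> fin_quot (dvr c).
Hypothesis complA : forall a : nat -> A, (forall n, dvr (x ^+ n) (a n.+1 - a n)) ->
  exists l, forall n, dvr (x ^+ n) (l - a n).
Hypothesis unitA : forall y, 1 + x * y \is a GRing.unit.

Lemma index_exists : exists N : A -> nat, N 0 = 0%N /\ forall c, c != 0 -> residues c (N c).
Proof.
have /choice[N NP] (c : A) : exists n, (c = 0 -> n = 0%N) /\ (c != 0 -> residues c n).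
  have [->|c0] := eqVneq c 0; first by exists 0%N.
  have [n nP] := residues_exist (fin_quotA c0).
  by exists n; split=> // c0'; rewrite c0' eqxx in c0.
by exists N; split=> [|c /(NP c).2//]; apply: (NP 0).1.
Qed.

(** The index of [c A] in [A], with the convention [idx 0 = 0]. *)
Definition idx : A -> nat := projT1 (cid index_exists).

Lemma idx0 : idx 0 = 0%N. Proof. exact: (projT2 (cid index_exists)).1. Qed.

Lemma idxP c : c != 0 -> residues c (idx c).
Proof. exact: (projT2 (cid index_exists)).2. Qed.

Lemma idxM a b : idx (a * b) = (idx a * idx b)%N.
Proof.
have [->|a0] := eqVneq a 0; first by rewrite mul0r idx0.
have [->|b0] := eqVneq b 0; first by rewrite mulr0 idx0 muln0.
apply: (@residues_unique _ (a * b)); first by apply: idxP; rewrite mulf_neq0.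
by apply: residuesM => //; apply: idxP.
Qed.

Lemma idx1 : idx 1 = 1%N.
Proof.
apply: (@residues_unique _ 1); first exact/idxP/oner_neq0.
exists [:: 0] => //; split=> // [z|r r']; last by rewrite !inE => /eqP-> /eqP->.
by exists 0; rewrite ?mem_head//; exists z; rewrite subr0 mulr1.
Qed.

Lemma idxX a n : idx (a ^+ n) = (idx a ^ n)%N.
Proof. by elim: n => [|n IH]; rewrite ?expr0 ?idx1// exprS idxM IH expnS. Qed.

Lemma idx_gt0 c : (0 < idx c)%N = (c != 0).
Proof.
have [->|c0] := eqVneq c 0; first by rewrite idx0.
by have [s <- [_ /(_ 0)[r + _] _]] := idxP c0; case: (s).
Qed.

Lemma idx_unit u : u \is a GRing.unit -> idx u = 1%N.
Proof.
move=> uu; have := idxM u u^-1; rewrite mulrV// idx1 => /esym/eqP.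
by rewrite muln_eq1 => /andP[/eqP].
Qed.

Lemma idx_eq1 c : idx c = 1%N -> dvr c 1.
Proof.
move=> c1; have c0 : c != 0 by rewrite -idx_gt0 c1.
have [s s1 [_ sP _]] := idxP c0; rewrite c1 in s1.
case: s s1 sP => [//|r [|//]] _ sP.
have [r0 /[1!inE] /eqP-> d1] := sP 1; have [r1 /[1!inE] /eqP-> d0] := sP 0.
by have := dvrB d1 d0; congr dvr; ring.
Qed.

Lemma idx_x_gt1 : (1 < idx x)%N.
Proof.
rewrite ltn_neqAle idx_gt0 x_neq0 andbT; apply/eqP => /esym/idx_eq1[w xw].
by have := unitA (- w); rewrite mulrN [x * w]mulrC -xw subrr unitr0.
Qed.

(** Two powers of [x] are congruent modulo [c], and [1 - x ^ k] is a unit. *)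
Lemma dvr_pow c : c != 0 -> dvr c (x ^+ idx c).
Proof.
move=> c0; have [s sz [_ sP _]] := idxP c0.
have /choice[g gP] i : exists r, r \in s /\ dvr c (x ^+ i - r).
  by have [r] := sP (x ^+ i); exists r.
have [|i [j [ij js gij]]] := @seq_pigeonhole _ g s; first by move=> i; have [] := gP i.
rewrite sz in js; apply: (@dvr_trans _ (x ^+ i)); last exact/dvr_exp/ltnW/(leq_trans ij).
have [_ di] := gP i; have [_ dj] := gP j.
have /(dvr_mull (1 + x * (- x ^+ (j - i).-1))^-1) := dvrB di dj; rewrite gij.
congr dvr; rewrite (_ : x ^+ i - g j - (x ^+ j - g j) = (1 + x * - x ^+ (j - i).-1) * x ^+ i).
  by rewrite mulKr.
rewrite mulrDl mul1r mulrN -exprS prednK ?subn_gt0// mulNr -exprD subnK; last exact: ltnW.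
by ring.
Qed.

(** A sequence of elements of unbounded index outside [x * A] would have, by
    compactness, a cluster point [l] outside [x * A]; but near [l != 0] the
    index is constant. *)
Lemma dvr_of_large_index : exists n, forall a, a != 0 -> (n < idx a)%N -> dvr x a.
Proof.
apply: contrapT => nN.
have /choice[a aP] n : exists a, [/\ a != 0, (n < idx a)%N & ~ dvr x a].
  apply: contrapT => na; apply: nN; exists n => a a0 an; apply: contrapT => nx.
  by apply: na; exists a.
(* A pair [(j, r)] such that infinitely many [a n] are congruent to [r] modulo
   [x^j]; refining the residue [r] again and again gives a Cauchy sequence. *)
pose state := {jr : nat * A | infinitely_often (fun n => dvr (x ^+ jr.1) (a n - jr.2))}.
have step (S : state) : exists S' : state,
    (sval S').1 = (sval S).1.+1 /\ dvr (x ^+ (sval S).1) ((sval S').2 - (sval S).2).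
  case: S => [[j r] /= inf_r]; have [s sP] := fin_quotA x_neq0.
  have [|rho inf_rho] := @infinitely_often_pigeonhole _ s _
      (fun n rho => dvr (x ^+ j.+1) (a n - (r + rho * x ^+ j))) _ inf_r.
    move=> n [w wE]; have [rho rhos [v vE]] := sP w; exists rho => //; exists v.
    transitivity ((w - rho) * x ^+ j); last by rewrite vE exprS mulrA.
    by rewrite mulrBl -wE; ring.
  exists (exist _ (j.+1, r + rho * x ^+ j) inf_rho); split=> //=.
  by exists rho; ring.
have S0 : infinitely_often (fun n => dvr (x ^+ 0) (a n - 0)).
  by move=> m; exists m => //; exists (a m); rewrite subr0 expr0 mulr1.
have [nxt nxtP] := choice step.
pose S n := iter n nxt (exist _ (0%N, 0) S0 : state).
have S1 n : (sval (S n)).1 = n by elim: n => [//|n IH]; rewrite (nxtP _).1 -/(S n) IH.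
have [n|l lP] := complA (a := fun n => (sval (S n)).2).
  by have [_] := nxtP (S n); rewrite S1.
have inf_l j : infinitely_often (fun n => dvr (x ^+ j) (a n - l)).
  move=> m; have [n mn] := svalP (S j) m; rewrite S1 => an; exists n => //.
  by have := dvrB an (lP j); congr dvr; ring.
have l_x : ~ dvr x l.
  move=> lx; have [n _ anl] := inf_l 1%N 0%N; have [_ _] := aP n; apply.
  by rewrite expr1 in anl; have := dvrD anl lx; rewrite subrK.
have l0 : l != 0 by apply/eqP => l0; apply: l_x; rewrite l0; apply: dvr0.
have [n ln [w wE]] := inf_l (idx l).+1 (idx l).
have [v vE] := dvr_pow l0; have [_ an _] := aP n.
have aE : a n = l * (1 + x * (w * v)).
  by rewrite -[LHS](subrK l) wE exprS vE; ring.
by move: an; rewrite aE idxM (idx_unit (unitA _)) muln1 ltnNge ln.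
Qed.

(** Write [c = x^i * c'] with [x] not dividing [c']. Both the index of [c'] and
    the power of [x] that it divides are bounded, and [a], whose index is at
    least that of [x^i], is almost divisible by [x^i]. *)
Lemma dvr_of_idx_le : exists n, forall a c, c != 0 -> a != 0 ->
  (idx c <= idx a)%N -> dvr c (x ^+ n * a).
Proof.
have [N NP] := dvr_of_large_index; have X1 := idx_x_gt1.
have divX i b : b != 0 -> (N * idx x ^ i < idx b)%N -> dvr (x ^+ i.+1) b.
  elim: i b => [|i IH] b b0; first by rewrite expn0 muln1; apply: NP.
  move=> Nb; have [|b1 bE] := NP b b0.
    by apply: leq_ltn_trans Nb; rewrite leq_pmulr// expn_gt0 ltnW.
  move: b0 Nb; rewrite bE mulf_eq0 => /norP[b1_0 _].
  rewrite idxM expnSr mulnA ltn_pmul2r ?(ltnW X1)// => /(IH _ b1_0)[w ->].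
  by exists w; rewrite -mulrA -exprSr.
exists (N + N)%N => a c c0 a0 ca.
have [i [c' [cE c'x]]] : exists i c', c = c' * x ^+ i /\ ~ dvr x c'.
  have [k ck] := ubnP (idx c); elim: k c ck c0 {ca} => [//|k IH] c ck c0.
  have [[c1 cE]|nx] := pselect (dvr x c); last by exists 0%N, c; rewrite mulr1.
  have c10 : c1 != 0 by apply: contraNneq c0 => c10; rewrite cE c10 mul0r.
  have [|//|i [c' [c1E c'x]]] := IH c1.
    rewrite cE idxM ltnS in ck; apply: leq_trans ck.
    by rewrite ltn_Pmulr// idx_gt0.
  by exists i.+1, c'; rewrite cE c1E exprSr mulrA.
have c'0 : c' != 0 by apply: contraNneq c0 => c'0; rewrite cE c'0 mul0r.
have c'N : (idx c' <= N)%N by rewrite leqNgt; apply/negP => /(NP _ c'0).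
have [v vE] := dvr_trans (dvr_pow c'0) (dvr_exp x c'N).
have [w wE] : dvr (x ^+ i) (x ^+ N * a).
  apply: dvr_trans (dvr_exp x (leqnSn i)) (divX _ _ _ _).
    by rewrite mulf_neq0// expf_neq0.
  rewrite idxM idxX; apply: (@leq_trans (idx x ^ N * idx x ^ i)).
    by rewrite ltn_pmul2r ?expn_gt0 ?(ltnW X1)//; apply: ltn_expl.
  rewrite leq_mul2l; apply/orP; right; apply: leq_trans ca.
  by rewrite cE idxM idxX leq_pmull// idx_gt0.
exists (w * v); transitivity (x ^+ N * (x ^+ N * a)); first by rewrite exprD mulrA.
by rewrite wE vE cE; ring.
Qed.

Local Notation K := {fraction A}.

(** The convention for [idx 0] gives the absolute value [0] to [0]. *)
Definition absA (a : A) : rat := (idx a)%:R^-1.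

Lemma absAM a b : absA (a * b) = absA a * absA b.
Proof. by rewrite /absA idxM natrM invfM. Qed.

Lemma absA_eq0 a : (absA a == 0) = (a == 0).
Proof. by rewrite invr_eq0 pnatr_eq0 eqn0Ngt idx_gt0 negbK. Qed.

Lemma abs_exists : exists f : K -> rat,
  forall a c, c != 0 -> f (a%:F / c%:F) = absA a / absA c.
Proof.
have /choice[g gP] (z : K) : exists ac : A * A, ac.2 != 0 /\ z = ac.1%:F / ac.2%:F.
  by have [a [c [c0 zE]]] := frac_repr z; exists (a, c).
exists (fun z => absA (g z).1 / absA (g z).2) => a c c0.
have [d0 /eqP] := gP (a%:F / c%:F); set d := (g _).2; set b := (g _).1.
rewrite eqr_div ?tofrac_eq0// -!tofracM tofrac_eq => /eqP e.
by apply/eqP; rewrite eqr_div ?absA_eq0// -!absAM e.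
Qed.

Definition abs : K -> rat := projT1 (cid abs_exists).

Lemma abs_frac a c : c != 0 -> abs (a%:F / c%:F) = absA a / absA c.
Proof. exact: (projT2 (cid abs_exists)). Qed.

Lemma abs_tofrac a : abs a%:F = absA a.
Proof.
rewrite -[a%:F]divr1 -(tofrac1 A) abs_frac ?oner_eq0//.
by rewrite {2}/absA idx1 invr1 divr1.
Qed.

Lemma absM y z : abs (y * z) = abs y * abs z.
Proof.
have [a [c [c0 ->]]] := frac_repr y; have [b [d [d0 ->]]] := frac_repr z.
by rewrite mulf_div -!tofracM !abs_frac ?mulf_neq0// !absAM mulf_div.
Qed.

Lemma abs1 : abs 1 = 1.
Proof. by rewrite -tofrac1 abs_tofrac /absA idx1 invr1. Qed.

Lemma abs0 : abs 0 = 0.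
Proof. by rewrite -tofrac0 abs_tofrac /absA idx0 invr0. Qed.

Lemma absX z n : abs (z ^+ n) = abs z ^+ n.
Proof. by elim: n => [|n IH]; rewrite ?expr0 ?abs1// !exprS absM IH. Qed.

Lemma abs_ge0 z : 0 <= abs z.
Proof. by have [a [c [c0 ->]]] := frac_repr z; rewrite abs_frac// divr_ge0// invr_ge0. Qed.

Lemma abs_eq0 z : (abs z == 0) = (z == 0).
Proof.
have [a [c [c0 ->]]] := frac_repr z; rewrite abs_frac// !mulf_eq0 (invr_eq0 (absA c)) (invr_eq0 c%:F).
by rewrite !absA_eq0 !tofrac_eq0.
Qed.

Lemma abs_gt0 z : (0 < abs z) = (z != 0).
Proof. by rewrite lt_def abs_eq0 abs_ge0 andbT. Qed.

Lemma absV z : abs z^-1 = (abs z)^-1.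
Proof.
have [->|z0] := eqVneq z 0; first by rewrite invr0 abs0 invr0.
apply: (mulfI (x := abs z)); first by rewrite abs_eq0.
by rewrite -absM !divff ?abs1// abs_eq0.
Qed.

Lemma abs_tofrac_le1 a : abs a%:F <= 1.
Proof.
rewrite abs_tofrac /absA; have [->|a0] := eqVneq a 0; first by rewrite idx0 invr0.
by rewrite invf_le1 ?ltr0n ?ler1n idx_gt0.
Qed.

Lemma abs_x_lt1 : abs x%:F < 1.
Proof. by rewrite abs_tofrac invf_lt1 ?ltr0n ?idx_gt0// ltr1n idx_x_gt1. Qed.

(** That [c] divides [x ^ n * a] means that [x ^ n] is a denominator of [a / c]. *)
Lemma abs_conductor : exists n, forall z, abs z <= 1 -> exists a, x%:F ^+ n * z = a%:F.
Proof.
have [n nP] := dvr_of_idx_le; exists n => z.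
have [a [c [c0 ->]]] := frac_repr z; rewrite abs_frac//.
have [->|a0] := eqVneq a 0; first by move=> _; exists 0; rewrite tofrac0 mul0r mulr0.
rewrite /absA invrK mulrC ler_pdivrMr ?ltr0n ?idx_gt0// mul1r ler_nat.
move=> /(nP _ _ c0 a0)[w wE]; exists w.
by rewrite mulrA -tofracXn -tofracM wE tofracM mulfK// tofrac_eq0.
Qed.

Variables (p : nat) (charA : p \in [pchar A]).

(** If [|y + z| > 1], its [q]-th powers are unbounded; but they equal
    [y^q + z^q], which has bounded denominator. *)
Lemma absD_le1 y z : abs y <= 1 -> abs z <= 1 -> abs (y + z) <= 1.
Proof.
move=> y1 z1; rewrite leNgt; apply/negP => yz1.
have [n nP] := abs_conductor.
have [e eP] := rat_pow_unbounded (abs x%:F ^- n) yz1.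
have le1X w m : abs w <= 1 -> abs (w ^+ m) <= 1 by move=> w1; rewrite absX exprn_ile1// abs_ge0.
have [a aE] := nP _ (le1X _ (p ^ e)%N y1); have [b bE] := nP _ (le1X _ (p ^ e)%N z1).
have := abs_tofrac_le1 (a + b).
rewrite tofracD -aE -bE -mulrDr -(frobD (pchar_frac charA)) absM !absX.
rewrite -ler_pdivlMl ?exprn_gt0 ?abs_gt0 ?tofrac_eq0// mulr1 leNgt eP//.
by rewrite ltnW// ltn_expl// (prime_gt1 (pcharf_prime charA)).
Qed.

Lemma absD_le r y z : abs y <= r -> abs z <= r -> abs (y + z) <= r.
Proof.
wlog yz : y z / abs y <= abs z => [wl|] yr zr.
  by have [/wl|/ltW/wl] := leP (abs y) (abs z); [|rewrite addrC]; apply.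
apply: le_trans zr; have [z0|z0] := eqVneq z 0.
  by move: yz; rewrite z0 abs0 addr0.
have -> : y + z = (y / z + 1) * z by rewrite mulrDl mul1r divfK.
rewrite absM ler_piMl ?abs_ge0// absD_le1 ?abs1//.
by rewrite absM absV ler_pdivrMr ?mul1r// abs_gt0.
Qed.

(** The denominators of the valuation ring are bounded, so its absolute values
    form a discrete set. *)
Lemma uniformizer : exists t, [/\ t != 0, abs t < 1 & forall z, abs z < 1 -> abs z <= abs t].
Proof.
have [n nP] := abs_conductor.
(* The absolute value of [b / x^n] is [idx x ^ n / idx b], so a largest value
   below [1] is obtained by minimizing [idx b]. *)
pose big m := `[< exists a, [/\ a != 0, idx a = m & (idx x ^ n < m)%N] >].
have exbig : exists m, big m.
  exists (idx x ^ n.+1)%N; apply/asboolP; exists (x ^+ n.+1); split.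
  - exact: expf_neq0.
  - exact: idxX.
  - by rewrite ltn_exp2l// idx_x_gt1.
case: (ex_minnP exbig) => m /asboolP[a [a0 am xm]] minm.
exists (a%:F / x%:F ^+ n); split; first by rewrite mulf_neq0 ?invr_eq0 ?expf_neq0 ?tofrac_eq0.
  rewrite -tofracXn abs_frac ?expf_neq0// /absA am idxX invrK mulrC.
  by rewrite ltr_pdivrMr ?mul1r ?ltr_nat// ltr0n (leq_ltn_trans _ xm).
move=> z z1; have [->|z0] := eqVneq z 0; first by rewrite abs0 abs_ge0.
have [b bE] := nP z (ltW z1).
have x0 : x%:F ^+ n != 0 :> K by rewrite expf_neq0 ?tofrac_eq0.
have b0 : b != 0 by rewrite -tofrac_eq0 -bE mulf_neq0.
have zE : z = b%:F / x%:F ^+ n by rewrite -bE mulrAC divff ?mul1r.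
move: z1; rewrite zE -tofracXn !abs_frac ?expf_neq0// ler_pM2r; last first.
  by rewrite invr_gt0 invr_gt0 ltr0n idx_gt0 expf_neq0.
rewrite /absA invrK mulrC ltr_pdivrMr ?ltr0n ?idx_gt0// mul1r ltr_nat idxX => xb.
rewrite lef_pV2 ?posrE ?ltr0n ?idx_gt0// ler_nat am minm//.
by apply/asboolP; exists b.
Qed.

(** The unit ball of the absolute value, with a uniformizer [t], satisfies the
    conditions of [ffrt_of_frobenius_parameter]; its completeness comes from that of
    [x ^- n * A], which contains it. *)
Lemma ffrt_of_complete : noetherian A -> finite_F_representation_type charA.
Proof.
move=> noethA; have [n nP] := abs_conductor; have [t [t0 t1 tP]] := uniformizer.
pose B z := abs z <= 1.
have xn0 : x%:F ^+ n != 0 :> K by rewrite expf_neq0 ?tofrac_eq0.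
have absx0 : 0 < abs x%:F by rewrite abs_gt0 tofrac_eq0.
have tdivE m z : tdiv B t m z <-> abs z <= abs t ^+ m.
  split=> [[b b1 ->]|zt]; first by rewrite absM absX ler_piMr// exprn_ge0 ?abs_ge0.
  exists (z / t ^+ m); last by rewrite mulrCA divff ?mulr1 ?expf_neq0.
  by rewrite /B absM absV absX ler_pdivrMr ?mul1r// exprn_gt0 ?abs_gt0.
have B_A a : B a%:F by apply: abs_tofrac_le1.
have B_D y z : B y -> B z -> B (y + z) by apply: absD_le1.
have B_M y z : B y -> B z -> B (y * z).
  by move=> By Bz; rewrite /B absM mulr_ile1 ?abs_ge0.
have B_t : B t by apply: ltW.
have tX m k : (k <= m)%N -> abs t ^+ m <= abs t ^+ k.
  by move=> km; rewrite ler_wiXn2l ?abs_ge0// ltW.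
have tsep b : (forall m, tdiv B t m b) -> b = 0.
  move=> bt; apply/eqP; rewrite -abs_eq0 eq_le abs_ge0 andbT leNgt; apply/negP => b0.
  have [|m mP] := @rat_pow_small (abs t) (abs b) _ b0; first by rewrite abs_ge0.
  by have /tdivE := bt m; rewrite leNgt mP.
have tred e b : B b -> tdiv B t 1 (b ^+ (p ^ e)) -> tdiv B t 1 b.
  have q_gt0 : (0 < p ^ e)%N by rewrite expn_gt0 (prime_gt0 (pcharf_prime charA)).
  move=> Bb /tdivE bt; apply/tdivE; rewrite expr1 in bt *; apply: tP.
  rewrite lt_neqAle (Bb : abs b <= 1) andbT; apply/eqP => b1.
  by move: bt; rewrite absX b1 expr1n leNgt t1.
have [s sP] := fin_quotA (expf_neq0 n.+1 x_neq0).
pose F := [seq r%:F / x%:F ^+ n | r <- s] : seq K.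
have Fres b : B b -> exists2 r, r \in F & tdiv B t 1 (b - r).
  move=> Bb; have [a aE] := nP b Bb; have [r rs [w wE]] := sP a.
  exists (r%:F / x%:F ^+ n); first by apply/mapP; exists r.
  apply/tdivE; rewrite expr1; apply: tP.
  have -> : b - r%:F / x%:F ^+ n = (w * x)%:F.
    apply: (mulfI xn0); rewrite mulrBr aE mulrCA divff// mulr1 -tofracB wE.
    by rewrite -tofracXn -tofracM exprS; congr (_%:F); ring.
  by rewrite tofracM absM (le_lt_trans _ abs_x_lt1)// ler_piMl ?abs_ge0 ?abs_tofrac_le1.
have [c cP] : exists c, forall m, (c <= m)%N -> abs t ^+ m < abs x%:F ^+ n.
  by apply: rat_pow_small; rewrite ?abs_ge0 ?exprn_gt0.
have tcond z : tdiv B t c z -> exists a, z = a%:F.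
  move=> /tdivE zt; have [|a aE] := nP (z / x%:F ^+ n).
    rewrite absM absV absX ler_pdivrMr ?exprn_gt0// mul1r.
    by apply: le_trans zt (ltW (cP _ _)).
  by exists a; rewrite -aE mulrCA divff ?mulr1.
have tcomp (r : nat -> K) : (forall j, B (r j)) ->
    exists2 b, B b & forall m, tdiv B t m (b - \sum_(j < m) t ^+ j * r j).
  move=> Br; pose S m := \sum_(j < m) t ^+ j * r j.
  have SS m k : (m <= k)%N -> abs (S k - S m) <= abs t ^+ m.
    move=> /subnKC <-; elim: (k - m)%N => [|i IH]; first by rewrite addn0 subrr abs0 exprn_ge0 ?abs_ge0.
    rewrite addnS /S big_ord_recr -/(S (m + i)%N) addrAC; apply: absD_le => //=.
    rewrite absM absX; apply: le_trans (tX _ _ (leq_addr i m)).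
    by rewrite ler_piMr ?exprn_ge0 ?abs_ge0//; apply: Br.
  have BS m : B (S m).
    by have := SS 0%N m (leq0n m); rewrite {2}/S big_ord0 subr0 expr0.
  (* The partial sums whose length is a multiple of [E.+1] are an [x]-adic Cauchy
     sequence, as [t^(E.+1)] is a multiple of [x] in the unit ball. *)
  have [E EP] : exists E, forall m, (E <= m)%N -> abs t ^+ m < abs x%:F.
    by apply: rat_pow_small => //; rewrite abs_ge0.
  have /choice[y yP] j : exists a, x%:F ^+ n * S (E.+1 * j)%N = a%:F by apply: nP; apply: BS.
  have [j|l lP] := complA (a := y).
    have [|w wE] := nP ((S (E.+1 * j.+1)%N - S (E.+1 * j)%N) / x%:F ^+ j).
      rewrite absM absV absX ler_pdivrMr ?exprn_gt0// mul1r.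
      apply: le_trans (SS _ _ _) _; first by rewrite leq_mul2l leqnSn orbT.
      by rewrite exprM lerXn2r ?nnegrE ?exprn_ge0 ?abs_ge0// ltW// EP.
    exists w; apply: (@tofrac_inj A); rewrite tofracB -!yP -mulrBr tofracM -wE tofracXn.
    by rewrite mulrA divfK// expf_neq0// tofrac_eq0.
  have near m : abs (l%:F / x%:F ^+ n - S m) <= abs t ^+ m.
    have [||j jP] := @rat_pow_small (abs x%:F) (abs t ^+ m * abs x%:F ^+ n).
    - by rewrite abs_ge0 abs_x_lt1.
    - by rewrite mulr_gt0 ?exprn_gt0 ?abs_gt0 ?tofrac_eq0.
    pose i := maxn j m; have [w wE] := lP i.
    have -> : l%:F / x%:F ^+ n - S m =
        (l%:F / x%:F ^+ n - S (E.+1 * i)%N) + (S (E.+1 * i)%N - S m) by ring.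
    apply: absD_le; last first.
      by apply: SS; rewrite (leq_trans (leq_maxr j m))// leq_pmull.
    have -> : l%:F / x%:F ^+ n - S (E.+1 * i)%N = (w%:F * x%:F ^+ i) / x%:F ^+ n.
      rewrite -[x%:F ^+ i]tofracXn -tofracM -wE tofracB -yP mulrBl; congr (_ - _).
      by rewrite mulrAC divff ?mul1r.
    rewrite !absM absV !absX ler_pdivrMr ?exprn_gt0// ltW//.
    apply: le_lt_trans (jP i (leq_maxl _ _)).
    by rewrite ler_piMl ?exprn_ge0 ?abs_ge0 ?abs_tofrac_le1.
  exists (l%:F / x%:F ^+ n) => [|m]; last by apply/tdivE/near.
  by have := near 0%N; rewrite /S big_ord0 subr0 expr0.
apply: (@ffrt_of_frobenius_parameter A p charA B t B_A B_D B_M t0 B_t c tcond noethA F Fres _ tred tsep).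
move=> e b Bb; apply: (frob_gen_of_complete charA B_A B_D B_M B_t tcomp tsep _ Bb).
exact: (residue_frob_surj charA B_A B_D B_M Fres tred).
Qed.

End CompleteDomain.

(** * Complete local rings *)

Section LocalRing.
Variables (A : idomainType) (k : finFieldType).
Hypotheses (noethA : noetherian A) (dimA : krull_dim_eq A 1).

Lemma ideal_powS (m : {pred A}) n z : ideal_pow m n.+1 z -> ideal_pow m n z.
Proof.
elim: n z => [//|n IH] z [s [sP ->]]; exists s; split=> // u us.
by have [? ?] := sP u us; split=> //; apply: IH.
Qed.

Lemma ideal_powW (m : {pred A}) i j z : (i <= j)%N -> ideal_pow m j z -> ideal_pow m i z.
Proof.
by move=> /subnK <-; elim: (j - i)%N => [//|n IH]; rewrite addSn => /ideal_powS.
Qed.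

Lemma ideal_pow_expr (m : {pred A}) n x w : x \in m -> ideal_pow m n (w * x ^+ n).
Proof.
move=> xm; elim: n w => [//|n IH] w; exists [:: (x, w * x ^+ n)]; split.
  by move=> _ /[1!inE] /eqP->; split=> //; apply: IH.
by rewrite big_seq1 /= exprS mulrCA.
Qed.

Section MaximalIdeal.
Variable m : idealr A.
Hypothesis loc : local_ring m.

(** An ideal that contains [y] and is maximal among the proper ones must be
    [m]. *)
Lemma local_unit y : y \notin m -> y \is a GRing.unit.
Proof.
move=> ym; apply: contrapT => yunit; apply: (negP ym).
have [||M [hM My M1] maxM] := @noetherian_max _ noethA
  (fun I => [/\ is_ideal I, I y & ~ I 1]) (dvr y).
- by move=> I [].
- split; [exact: dvr_ideal | exact: dvrr |].
  by move=> [w /esym wy]; apply: yunit; apply/unitrP; exists w; rewrite [y * w]mulrC.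
have maxJ : maximal_ideal (ideal_pred hM M1).
  move=> J MJ z zJ; apply/asboolP; apply: (maxM (fun z => z \in J)) => //.
    split; [exact: is_ideal_idealr | | by rewrite idealr1].
    by apply: MJ; apply/asboolP.
  by move=> w Mw; apply: MJ; apply/asboolP.
by rewrite -(loc.2 _ maxJ); apply/asboolP.
Qed.

Lemma local_maximal_prime : is_prime (fun z => z \in m).
Proof.
split=> [||a b abm]; [exact: is_ideal_idealr | by rewrite idealr1 |].
have [am|/local_unit au] := boolP (a \in m); [by left | right].
by rewrite -[b](mulKr au); apply: idealMr.
Qed.

Lemma local_prime_sub P z : is_prime P -> P z -> z \in m.
Proof.
move=> [hP P1 _] Pz; apply: contrapT => /negP/local_unit zu; apply: P1.
by rewrite -(mulVr zu); apply: idealM.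
Qed.

Lemma local_prime_eq P z : is_prime P -> (exists2 x, P x & x != 0) -> z \in m -> P z.
Proof.
move=> hP Px; apply: (prime_dim1 dimA hP local_maximal_prime) => // y.
exact: local_prime_sub.
Qed.

Lemma local_nonzero_mem : exists2 x, x \in m & x != 0.
Proof.
have [[C chC] _] := dimA.
have [_ nsub] := chC ord0 (lift ord0 ord0) isT.
apply: contrapT => nx; apply: nsub => z zC.
have zm := local_prime_sub (is_prime_idealr _) zC.
have [->|z0] := eqVneq z 0; first exact: idealr0.
by case: nx; exists z.
Qed.

Lemma fin_quot_residue_field (f : {rmorphism {ideal_quot m} -> k}) : bijective f ->
  fin_quot (fun z => z \in m).
Proof.
move=> [g fK gK]; exists [seq repr (g c) | c <- enum k] => z.
exists (repr (g (f (\pi_{ideal_quot m} z)%qT))); first by apply/map_f; rewrite mem_enum.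
by rewrite Quotient.idealrBE fK reprK.
Qed.

End MaximalIdeal.

(** As [m] is the only prime that contains a nonzero nonunit, quotients by
    principal ideals are finite and the [m]-adic topology is the [x]-adic
    one. *)
Lemma ffrt_complete_local (p : nat) (charA : p \in [pchar A]) :
  complete_local A k -> finite_F_representation_type charA.
Proof.
move=> [m [loc compl [f f_bij]]].
have [x xm x0] := local_nonzero_mem loc.
have sub_prime (c : A) P : c != 0 -> is_prime P -> (forall z, dvr c z -> P z) ->
    forall z, z \in m -> P z.
  move=> c0 hP cP z; apply: (local_prime_eq loc hP); exists c => //.
  exact/cP/dvrr.
have finA (c : A) : c != 0 -> fin_quot (dvr c).
  move=> c0; apply: (@fin_quot_of_primes _ noethA (dvr c)) => [|P hP cP]; first exact: dvr_ideal.
  have [s sP] := fin_quot_residue_field f_bij; exists s => z.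
  by have [r rs zr] := sP z; exists r => //; apply: (sub_prime c).
have powA (c : A) : c != 0 -> exists n, forall z, ideal_pow m n z -> dvr c z.
  move=> c0; apply: (ideal_pow_sub_of_primes noethA) => [|P hP cP]; first exact: dvr_ideal.
  exists 1%N => z [s [sP ->]]; apply: (sub_prime c) => //.
  rewrite big_seq; apply: rpred_sum => u /sP[um _]; rewrite mulrC; exact: idealMr.
apply: (ffrt_of_complete x0 finA) => // [a aP|y].
  have [n|l [lP _]] := compl a.
    by have [w ->] := aP n; apply: ideal_pow_expr.
  exists l => n; have [K KP] := powA _ (expf_neq0 n x0).
  have an j : dvr (x ^+ n) (a (n + j)%N - a n).
    elim: j => [|j IH]; first by rewrite addn0 subrr; apply: dvr0.
    rewrite addnS -[a _](subrK (a (n + j)%N)) -addrA; apply: dvrD => //.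
    apply: dvr_trans (aP _); exact/dvr_exp/leq_addr.
  rewrite -[l](subrK (a (n + K)%N)) -addrA; apply: dvrD => //; apply: KP.
  by apply: ideal_powW (lP _); apply: leq_addl.
apply: contrapT => /negP nu; have : 1 + x * y \in m by apply: contraNT nu => /local_unit; apply.
move=> h; have := rpredB h (idealMr y xm : y * x \in m).
by rewrite [y * x]mulrC addrK idealr1.
Qed.

End LocalRing.

(** * Graded domains *)

Section Graded.
Variables (A : idomainType) (G : nat -> {pred A}).
Hypothesis gradG : grading G.

Lemma grade0 i : 0 \in G i.
Proof. by have [] := grading_zmod gradG i. Qed.

Lemma gradeB i a b : a \in G i -> b \in G i -> a - b \in G i.
Proof. by have [_ h] := grading_zmod gradG i; apply: h. Qed.

Lemma gradeN i a : a \in G i -> - a \in G i.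
Proof. by move=> aG; rewrite -sub0r; apply: gradeB => //; apply: grade0. Qed.

Lemma gradeD i a b : a \in G i -> b \in G i -> a + b \in G i.
Proof. by move=> aG bG; rewrite -[b]opprK; apply: gradeB => //; apply: gradeN. Qed.

Lemma gradeM i j a b : a \in G i -> b \in G j -> a * b \in G (i + j)%N.
Proof. exact: (grading_mul gradG). Qed.

Lemma gradeX i a n : a \in G i -> a ^+ n \in G (n * i)%N.
Proof.
move=> aG; elim: n => [|n IH]; first exact: (grading_one gradG).
by rewrite exprS mulSn; apply: gradeM.
Qed.

Lemma components_exist a : exists q : {poly A}, (forall i, q`_i \in G i) /\ q.[1] = a.
Proof.
have [n [x [xG ->]]] := grading_span gradG a; exists (\poly_(i < n) x i); split.
  by move=> i; rewrite coef_poly; case: ifP => // _; apply: grade0.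
by rewrite horner_poly; apply: eq_bigr => i _; rewrite expr1n mulr1.
Qed.

(** The homogeneous components of [a], collected in a polynomial; this turns
    the grading into the multiplication of polynomials. *)
Definition components a : {poly A} := projT1 (cid (components_exist a)).
Definition component a i := (components a)`_i.

Lemma component_grade a i : component a i \in G i.
Proof. exact: (projT2 (cid (components_exist a))).1. Qed.

Lemma horner_components a : (components a).[1] = a.
Proof. exact: (projT2 (cid (components_exist a))).2. Qed.

Lemma components_unique a (q : {poly A}) :
  (forall i, q`_i \in G i) -> q.[1] = a -> components a = q.
Proof.
move=> qG qa; apply/subr0_eq; set r := components a - q.
have r1 : \sum_(i < size r) r`_i = 0.
  transitivity r.[1]; last by rewrite hornerD hornerN horner_components qa subrr.
  by rewrite horner_coef; apply: eq_bigr => i _; rewrite expr1n mulr1.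
apply/polyP=> i; rewrite coef0; have [ir|] := ltnP i (size r); last exact: nth_default.
apply: (grading_indep gradG) r1 i ir => i.
by rewrite coefB; apply: gradeB => //; apply: component_grade.
Qed.

Lemma componentsB a b : components (a - b) = components a - components b.
Proof.
apply: components_unique => [i|]; last by rewrite hornerD hornerN !horner_components.
by rewrite coefB; apply: gradeB; apply: component_grade.
Qed.

Lemma componentsM a b : components (a * b) = components a * components b.
Proof.
apply: components_unique => [i|]; last by rewrite hornerM !horner_components.
rewrite coefM; apply: (big_ind (fun x => x \in G i)) => [|x y|j _]; [exact: grade0 | exact: gradeD |].
by rewrite -[X in G X](subnKC (leq_ord j)); apply: gradeM; apply: component_grade.
Qed.

Lemma components_grade i a : a \in G i -> components a = a *: 'X^i.
Proof.
move=> aG; apply: components_unique => [j|]; last by rewrite hornerZ hornerXn expr1n mulr1.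
by rewrite coefZ coefXn; case: eqP => [->|_]; rewrite ?mulr1// mulr0; apply: grade0.
Qed.

Lemma componentB a b i : component (a - b) i = component a i - component b i.
Proof. by rewrite /component componentsB coefB. Qed.

Lemma component0 i : component 0 i = 0.
Proof. by rewrite -{1}(subrr (0 : A)) componentB subrr. Qed.

Lemma componentD a b i : component (a + b) i = component a i + component b i.
Proof.
have bN : component (- b) i = - component b i by rewrite -sub0r componentB component0 sub0r.
by rewrite -{1}[b]opprK componentB bN opprK.
Qed.

Lemma component_id i a : a \in G i -> component a i = a.
Proof. by move=> /components_grade; rewrite /component => ->; rewrite coefZ coefXn eqxx mulr1. Qed.

Lemma component_neq i j a : a \in G i -> j != i -> component a j = 0.
Proof.
move=> /components_grade; rewrite /component => -> /negPf ji.
by rewrite coefZ coefXn ji mulr0.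
Qed.

Lemma component_mulr i a b j : b \in G i ->
  component (a * b) j = if (j < i)%N then 0 else component a (j - i) * b.
Proof.
move=> /components_grade bE; rewrite /component componentsM bE -scalerAr coefZ coefMXn.
by case: ifP => _; rewrite ?mulr0// mulrC.
Qed.

(** The quotient need only be replaced by its component of the right degree. *)
Lemma dvr_grade i j a c : c \in G j -> a \in G i -> a != 0 -> dvr c a ->
  (j <= i)%N /\ exists2 w, w \in G (i - j)%N & a = w * c.
Proof.
move=> cG aG a0 [w aE]; have := component_id aG.
rewrite {1}aE (component_mulr _ _ cG); case: ltnP => [_ a0'|ji wE].
  by rewrite -a0' eqxx in a0.
by split=> //; exists (component w (i - j)); rewrite ?component_grade.
Qed.

Definition irrelevant a := component a 0%N = 0.

Lemma component0M a b : component (a * b) 0%N = component a 0%N * component b 0%N.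
Proof. by rewrite /component componentsM coef0M. Qed.

Lemma irrelevant_prime : is_prime irrelevant.
Proof.
rewrite /irrelevant; split=> [||a b].
- split=> [|a x y x0 y0]; first exact: component0.
  by rewrite componentD component0M x0 y0 mulr0 addr0.
- by rewrite (component_id (grading_one gradG)); apply/eqP/oner_neq0.
- by rewrite component0M => /eqP; rewrite mulf_eq0 => /orP[]/eqP; [left|right].
Qed.

Lemma grade_irrelevant i a : (0 < i)%N -> a \in G i -> irrelevant a.
Proof. by move=> i0 aG; apply: (component_neq aG); rewrite eq_sym -lt0n. Qed.

Section DegreeGap.
Hypothesis gcdG : is_gcd (fun i => exists2 a, a \in G i & a != 0) 1.

(** The positive differences of degrees of nonzero homogeneous elements are the
    multiples of the smallest one, which therefore divides all degrees. *)
Lemma consecutive_degrees : exists j, exists2 uw : A * A,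
  uw.1 \in G j.+1 /\ uw.2 \in G j & uw.1 != 0 /\ uw.2 != 0.
Proof.
pose D i := exists2 a, a \in G i & a != 0.
have D0 : D 0%N by exists 1; rewrite ?oner_neq0// (grading_one gradG).
have DD i j : D i -> D j -> D (i + j)%N.
  by move=> [a aG a0] [b bG b0]; exists (a * b); [apply: gradeM | rewrite mulf_neq0].
have DM n i : D i -> D (n * i)%N by move=> Di; elim: n => [//|n IH]; rewrite mulSn; apply: DD.
pose gap g := `[< (0 < g)%N /\ exists j, D j /\ D (j + g)%N >].
have exgap : exists g, gap g.
  apply: contrapT => ngap; suff : (2 %| 1)%N by [].
  apply: gcdG.2 => -[//|i] Di; exfalso; apply: ngap; exists i.+1; apply/asboolP.
  by split=> //; exists 0%N.
case: (ex_minnP exgap) => g /asboolP[g0 [j [Dj Djg]]] ming.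
have g1 : g = 1%N.
  apply/eqP; rewrite -dvdn1; apply: gcdG.2 => i Di.
  rewrite /dvdn; apply/eqP; apply: contrapT => /eqP; rewrite -lt0n => r0.
  suff : (g <= i %% g)%N by rewrite leqNgt ltn_mod g0.
  apply: ming; apply/asboolP; split=> //; exists (i %/ g * (j + g))%N; split; first exact: DM.
  have -> : (i %/ g * (j + g) + i %% g = i + i %/ g * j)%N.
    by rewrite {3}(divn_eq i g) mulnDr; lia.
  by apply: DD => //; apply: DM.
move: Djg; rewrite g1 addn1 => -[u uG u0]; have [w wG w0] := Dj.
by exists j, (u, w).
Qed.

End DegreeGap.

Variable k : finFieldType.
Variable iota : {rmorphism k -> A}.
Hypothesis G0k : forall a, a \in G 0%N <-> exists c : k, a = iota c.
Hypotheses (noethA : noetherian A) (dimA : krull_dim_eq A 1).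

Lemma fin_quot_irrelevant : fin_quot irrelevant.
Proof.
exists [seq iota c | c <- enum k] => z.
have /G0k[c cE] := component_grade z 0%N.
exists (iota c); first by apply/map_f; rewrite mem_enum.
by rewrite /irrelevant componentB cE [X in _ - X]component_id ?subrr//; apply/G0k; exists c.
Qed.

(** Otherwise some prime containing [c], contained in the irrelevant ideal, and
    not containing [y] would lie strictly between [0] and that ideal. *)
Lemma grade_dvr_pow i j c y : c \in G j -> c != 0 -> y \in G i -> (0 < i)%N ->
  exists n, dvr c (y ^+ n).
Proof.
move=> cG c0 yG i0; have [_ irr1 irrM] := irrelevant_prime.
have [||||_ [n [s [-> s0]]] csn] := @meets_of_primes _ noethA
    (fun z => exists n s, z = s * y ^+ n /\ ~ irrelevant s) (dvr c).
- by exists 0%N, 1; split; rewrite ?mulr1.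
- move=> _ _ [n [s [-> s0]]] [n' [s' [-> s'0]]]; exists (n + n')%N, (s * s').
  by split=> [|/irrM[]//]; rewrite exprD mulrACA.
- exact: dvr_ideal.
- move=> P hP cP; apply: contrapT => nS; have Pc := cP _ (dvrr c).
  have Pirr z : P z -> irrelevant z.
    move=> Pz; apply: contrapT => z0; apply: nS; exists z => //.
    by exists 0%N, z; split; rewrite ?mulr1.
  apply: nS; exists y; first by exists 1%N, 1; split; rewrite ?mul1r.
  apply: (prime_dim1 dimA hP irrelevant_prime Pirr); first by exists c.
  exact: grade_irrelevant yG.
exists n; have [v vE] := csn; have ynG := gradeX n yG.
have := congr1 (component^~ (n * i)%N) vE.
rewrite /= (component_mulr _ _ ynG) ltnn subnn (component_mulr _ _ cG).
have /G0k[b bE] := component_grade s 0%N; have b0 : b != 0.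
  by apply/eqP => b0; apply: s0; rewrite /irrelevant bE b0 rmorph0.
rewrite bE => sE; have -> : y ^+ n = iota b^-1 * (iota b * y ^+ n).
  by rewrite mulrA -rmorphM mulVf// rmorph1 mul1r.
apply: dvr_mull; rewrite sE; case: ifP => _; first exact: dvr0.
by exists (component v (n * i - j)).
Qed.

(** A prime containing [c] contains all homogeneous elements of positive degree,
    as some power of each of them is divisible by [c]. *)
Lemma fin_quot_grade j c : c \in G j -> c != 0 -> fin_quot (dvr c).
Proof.
move=> cG c0; apply: (@fin_quot_of_primes _ noethA (dvr c)) => [|P hP cP]; first exact: dvr_ideal.
have [hPi P1 PM] := hP.
have Pgrade i y : (0 < i)%N -> y \in G i -> P y.
  move=> i0 yG; have [n /cP] := grade_dvr_pow cG c0 yG i0.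
  by elim: n => [//|n IH]; rewrite exprS => /PM[|/IH].
have [s sP] := fin_quot_irrelevant; exists s => z.
have [r rs zr0] := sP z; exists r => //.
rewrite -(horner_components (z - r)) horner_coef.
apply: big_ind => [||[[|i] hi] _ /=]; first exact: hPi.1.
- by move=> ? ?; apply: idealD.
- by rewrite [_`_0]zr0 mul0r; apply: hPi.1.
- by rewrite mulrC; apply: idealM => //; apply: (Pgrade i.+1) => //; apply: component_grade.
Qed.

Section HomogeneousLocalization.
Local Notation K := {fraction A}.
Variables (d : nat) (x w : A).
Hypotheses (xG : x \in G d) (x0 : x != 0) (wG : w \in G d.-1) (w0 : w != 0) (d0 : (0 < d)%N).

Let xK_neq0 : x%:F != 0 :> K. Proof. by rewrite tofrac_eq0. Qed.
Let wK_neq0 : w%:F != 0 :> K. Proof. by rewrite tofrac_eq0. Qed.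
Let xX_neq0 n : x%:F ^+ n != 0 :> K. Proof. exact: expf_neq0. Qed.

(** Since [A / x] is finite, the degrees of a system of residues are bounded;
    beyond the bound multiplication by [x] is onto. *)
Lemma grade_divisible : exists N, forall i j a, (N <= i)%N -> a \in G (i + j * d)%N ->
  exists2 z, z \in G i & a = z * x ^+ j.
Proof.
have [s sP] := fin_quot_grade xG x0.
pose N := (\max_(r <- s) size (components r))%N.
have step i a : (N <= i)%N -> a \in G (i + d)%N -> exists2 z, z \in G i & a = z * x.
  move=> Ni aG; have [r rs [v vE]] := sP a.
  exists (component v i); first exact: component_grade.
  have := congr1 (component^~ (i + d)%N) vE.
  rewrite /= (component_mulr _ _ xG) ltnNge leq_addl addnK componentB component_id//= => <-.
  rewrite [component r _]nth_default ?subr0//.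
  apply: leq_trans (leq_addr _ _); apply: leq_trans Ni.
  exact: leq_bigmax_seq.
exists N => i j; elim: j => [|j IH] a Ni aG.
  by exists a; rewrite ?mulr1//; rewrite mul0n addn0 in aG.
rewrite mulSnr addnA in aG.
have [|b bG ->] := step _ _ _ aG; first exact: leq_trans (leq_addr _ _).
by have [z zG ->] := IH b Ni bG; exists z; rewrite // exprSr mulrA.
Qed.

(** The degree [i] part of the localization of [A] at [x]. *)
Definition hom i (z : K) := exists j, exists2 a, a \in G (i + j * d)%N & x%:F ^+ j * z = a%:F.

Lemma hom_raise i z j n a : a \in G (i + j * d)%N -> x%:F ^+ j * z = a%:F ->
  x ^+ n * a \in G (i + (n + j) * d)%N /\ x%:F ^+ (n + j) * z = (x ^+ n * a)%:F.
Proof.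
move=> aG aE; split; last by rewrite exprD -mulrA aE tofracM tofracXn.
by rewrite mulnDl addnCA; apply: gradeM => //; apply: gradeX.
Qed.

Lemma hom_grade i a : a \in G i -> hom i a%:F.
Proof. by move=> aG; exists 0%N, a; rewrite ?mul1r// addn0. Qed.

Lemma hom0 i : hom i 0.
Proof. by rewrite -tofrac0; apply/hom_grade/grade0. Qed.

Lemma homB i y z : hom i y -> hom i z -> hom i (y - z).
Proof.
move=> [j [a aG aE]] [l [b bG bE]]; exists (j + l)%N.
have [aG' aE'] := hom_raise l aG aE; have [bG' bE'] := hom_raise j bG bE.
rewrite [(l + j)%N]addnC in aG' aE'; exists (x ^+ l * a - x ^+ j * b); first exact: gradeB.
by rewrite mulrBr aE' bE' -tofracB.
Qed.

Lemma homD i y z : hom i y -> hom i z -> hom i (y + z).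
Proof.
move=> hy hz; rewrite -[z]opprK; apply: homB => //.
by rewrite -sub0r; apply: homB => //; apply: hom0.
Qed.

Lemma homM i j y z : hom i y -> hom j z -> hom (i + j) (y * z).
Proof.
move=> [m [a aG aE]] [n [b bG bE]]; exists (m + n)%N, (a * b).
  by rewrite mulnDl addnACA; apply: gradeM.
by rewrite exprD mulrACA aE bE tofracM.
Qed.

Lemma homX i z n : hom i z -> hom (n * i) (z ^+ n).
Proof.
move=> hz; elim: n => [|n IH]; last by rewrite exprS mulSn; apply: homM.
by rewrite expr0 -tofrac1; apply/hom_grade/(grading_one gradG).
Qed.

Lemma hom_large : exists N, forall i z, (N <= i)%N -> hom i z -> exists2 a, a \in G i & z = a%:F.
Proof.
have [N NP] := grade_divisible; exists N => i z Ni [j [a aG aE]].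
have [b bG bE] := NP _ _ _ Ni aG; exists b => //.
by apply: (mulfI (xX_neq0 j)); rewrite aE bE mulrC tofracM tofracXn.
Qed.

(** A residue class modulo [x ^ (i + 1)] contains at most one homogeneous element
    of degree [i], since all nonzero multiples of [x ^ (i + 1)] live in higher
    degrees. *)
Lemma grade_finite i : exists s : seq A, forall a, a \in G i -> a \in s.
Proof.
have xi := gradeX i.+1 xG; have [s sP] := fin_quot_grade xi (expf_neq0 _ x0).
have /choice[f fP] (r : A) : exists a, forall b, b \in G i -> dvr (x ^+ i.+1) (b - r) -> b = a.
  have [[a [aG ar]]|na] := pselect (exists a, a \in G i /\ dvr (x ^+ i.+1) (a - r)); last first.
    by exists 0 => b bG br; case: na; exists b.
  exists a => b bG br; have [v vE] := dvrB br ar.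
  have := congr1 (component^~ i) vE; rewrite /= (component_mulr _ _ xi) ifT; last first.
    by rewrite leq_pmulr.
  have -> : b - r - (a - r) = b - a by ring.
  by rewrite component_id ?gradeB// => /subr0_eq.
exists (map f s) => a aG; have [r rs ar] := sP a.
by apply/mapP; exists r => //; apply: fP.
Qed.

(** All of [hom 0] has the common denominator [x ^ N]. *)
Lemma hom0_finite : exists s : seq K, forall z, hom 0 z -> z \in s.
Proof.
have [N NP] := hom_large; have [s sP] := grade_finite (N * d).
exists [seq a%:F / x%:F ^+ N | a <- s] => z hz.
have [||a aG aE] := NP (N * d)%N (x%:F ^+ N * z); first by rewrite leq_pmulr.
  by rewrite -[(N * d)%N]addn0; apply: homM hz; apply/homX/hom_grade.
apply/mapP; exists a; first exact: sP.
by rewrite -aE mulrAC divff ?mul1r.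
Qed.

Definition degree_one : K := x%:F / w%:F.
Local Notation t := degree_one.

Lemma t_neq0 : t != 0.
Proof. by rewrite mulf_neq0 ?invr_eq0. Qed.

(** Some power of [x] is divisible by [w], so that powers of [x] suffice as
    denominators. *)
Lemma hom_t : hom 1 t.
Proof.
have [n wx] := grade_dvr_pow wG w0 xG d0; have xnG := gradeX n xG.
have [le_n [v vG vE]] := dvr_grade wG xnG (expf_neq0 n x0) wx.
exists n, (v * x).
  have -> : (1 + n * d = n * d - d.-1 + d)%N by lia.
  exact: gradeM.
by rewrite /degree_one mulrCA -tofracXn vE !tofracM mulfK// mulrC.
Qed.

Lemma hom_tX n : hom n (t ^+ n).
Proof. by have := homX n hom_t; rewrite muln1. Qed.

(** The homogeneous elements of [A] are multiples of powers of [t]: the inverse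
    of [t] is also in the localization. *)
Lemma hom_grade_t i a : a \in G i -> exists2 c, hom 0 c & a%:F = c * t ^+ i.
Proof.
move=> aG; exists (a%:F / t ^+ i); last by rewrite divfK// expf_neq0// t_neq0.
exists i, (a * w ^+ i).
  have -> : (0 + i * d = i + i * d.-1)%N by rewrite -{1}(prednK d0) mulnS.
  by apply: gradeM => //; apply: gradeX.
rewrite /degree_one expr_div_n invf_div tofracM tofracXn mulrCA; congr (_ * _).
by rewrite mulrCA divff ?mulr1.
Qed.

(** The subring of [K] generated by [hom 0] and [t], built up by Horner's scheme
    so that the constant coefficient is at hand. *)
Inductive tpoly : K -> Prop :=
| TPoly0 : tpoly 0
| TPolyS c z : hom 0 c -> tpoly z -> tpoly (c + t * z).

Lemma tpolyC c : hom 0 c -> tpoly c.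
Proof. by move=> hc; rewrite -[c]addr0 -(mulr0 t); apply: TPolyS => //; apply: TPoly0. Qed.

Lemma tpolyT z : tpoly z -> tpoly (t * z).
Proof. by move=> hz; rewrite -[t * z]add0r; apply: TPolyS => //; apply: hom0. Qed.

Lemma tpolyD y z : tpoly y -> tpoly z -> tpoly (y + z).
Proof.
move=> hy; elim: hy z => [z|c y' hc hy' IH _ [|c' z hc' hz]]; rewrite ?add0r ?addr0//.
  exact: TPolyS.
by rewrite addrACA -mulrDr; apply: TPolyS; [apply: homD | apply: IH].
Qed.

Lemma tpolyM y z : tpoly y -> tpoly z -> tpoly (y * z).
Proof.
move=> hy hz; elim: hy => [|c y' hc _ IH]; first by rewrite mul0r; apply: TPoly0.
rewrite mulrDl -mulrA; apply: tpolyD; last exact: tpolyT.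
elim: hz {IH} => [|c' z' hc' _ IH]; first by rewrite mulr0; apply: TPoly0.
by rewrite mulrDr mulrCA; apply: TPolyS => //; rewrite -[0%N]addn0; apply: homM.
Qed.

Lemma tpoly_t : tpoly t.
Proof.
rewrite -[t]mulr1; apply/tpolyT/tpolyC; rewrite -tofrac1.
exact/hom_grade/(grading_one gradG).
Qed.

Lemma tpoly_tofrac a : tpoly a%:F.
Proof.
rewrite -(horner_components a) horner_coef rmorph_sum /=.
apply: (big_ind tpoly) => [||i _]; [exact: TPoly0 | exact: tpolyD |].
rewrite expr1n mulr1; have [c hc ->] := hom_grade_t (component_grade a i).
elim: (nat_of_ord i) => [|n IH]; first by rewrite mulr1; apply: tpolyC.
by rewrite exprS mulrCA; apply: tpolyT.
Qed.

(** [z] has order at least [e] at the irrelevant ideal. *)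
Definition order_ge e (z : K) := exists j, exists2 a, x%:F ^+ j * z = a%:F &
  forall l, (l < e + j * d)%N -> component a l = 0.

(** The order does not depend on the denominator chosen to compute it. *)
Lemma order_geP e z j a : order_ge e z -> x%:F ^+ j * z = a%:F ->
  forall l, (l < e + j * d)%N -> component a l = 0.
Proof.
move=> [j' [a' a'E a'0]] aE l lt_l.
have e2 : a * x ^+ j' = a' * x ^+ j.
  apply: (@tofrac_inj A); rewrite !tofracM -aE -a'E !tofracXn.
  by rewrite mulrAC [RHS]mulrAC [x%:F ^+ j * _]mulrC.
have := congr1 (component^~ (l + j' * d)%N) e2; rewrite /= !(component_mulr _ _ (gradeX _ xG)).
rewrite [X in if X then _ else _]ltnNge leq_addl addnK.
have -> : (if (l + j' * d < j * d)%N then 0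
    else component a' (l + j' * d - j * d) * x ^+ j) = 0.
  by case: ltnP => // jl; rewrite a'0 ?mul0r//; lia.
by move/eqP; rewrite mulf_eq0 (negPf (expf_neq0 _ x0)) orbF => /eqP.
Qed.

Lemma order_geD e y z : order_ge e y -> order_ge e z -> order_ge e (y + z).
Proof.
move=> [j [a aE a0]] [l [b bE b0]]; exists (j + l)%N, (x ^+ l * a + x ^+ j * b).
  by rewrite exprD tofracD !tofracM -aE -bE !tofracXn; ring.
move=> i lt_i; rewrite componentD ![x ^+ _ * _]mulrC !(component_mulr _ _ (gradeX _ xG)).
by do 2?[case: ltnP => ?]; rewrite ?a0 ?b0 ?mul0r ?addr0//; lia.
Qed.

Lemma order_geW e e' z : (e' <= e)%N -> order_ge e z -> order_ge e' z.
Proof.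
move=> ee' [j [a aE a0]]; exists j, a => // l l_e; apply: a0.
by apply: leq_trans l_e _; rewrite leq_add2r.
Qed.

Lemma order_ge_hom i z : hom i z -> order_ge i z.
Proof.
move=> [j [a aG aE]]; exists j, a => // l lt_l.
by apply: (component_neq aG); rewrite ltn_eqF.
Qed.

Lemma order_geMhom i e y z : hom i y -> order_ge e z -> order_ge (i + e) (y * z).
Proof.
move=> [j [a aG aE]] [l [b bE b0]]; exists (j + l)%N, (b * a).
  by rewrite exprD mulrACA aE bE mulrC tofracM.
move=> n lt_n; rewrite (component_mulr _ _ aG); case: ltnP => // le_n.
by rewrite b0 ?mul0r//; move: lt_n; rewrite mulnDl; lia.
Qed.

Lemma order_ge_tpoly z : tpoly z -> order_ge 0 z.
Proof.
elim=> [|c y hc _ IH]; first exact/order_ge_hom/hom0.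
apply: order_geD; first exact: order_ge_hom.
by apply: (@order_geW 1) => //; apply: (@order_geMhom 1 0) IH; apply: hom_t.
Qed.

(** A multiple of [t] has positive order, whereas a nonzero constant has order
    zero. *)
Lemma tpoly_const_eq0 c z : hom 0 c -> tpoly z -> c = t * z -> c = 0.
Proof.
move=> [j [a aG aE]] hz cE; have ord_c : order_ge 1 c.
  by rewrite cE; apply: (@order_geMhom 1 0) hom_t (order_ge_tpoly hz).
have := order_geP ord_c aE (ltnSn _); rewrite component_id// => a0.
by apply/eqP; move/eqP: aE; rewrite a0 tofrac0 mulf_eq0 (negPf (xX_neq0 j)).
Qed.

Lemma tpolyX z n : tpoly z -> tpoly (z ^+ n).
Proof.
move=> hz; elim: n => [|n IH]; last by rewrite exprS; apply: tpolyM.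
by rewrite expr0 -tofrac1; apply: tpoly_tofrac.
Qed.

Variables (p : nat) (charA : p \in [pchar A]).
Let q_gt0 e : (0 < p ^ e)%N.
Proof. by rewrite expn_gt0 (prime_gt0 (pcharf_prime charA)). Qed.

Lemma tdiv_tpoly n z : tdiv tpoly t n z -> order_ge n z.
Proof.
move=> [b hb ->]; rewrite -[n in order_ge n]addn0.
exact: order_geMhom (hom_tX n) (order_ge_tpoly hb).
Qed.

Lemma tpoly_reduced e b : tpoly b -> tdiv tpoly t 1 (b ^+ (p ^ e)) -> tdiv tpoly t 1 b.
Proof.
move=> [|c z hc hz] [y hy yE]; first by exists 0; [apply: TPoly0 | rewrite mulr0].
suff c0 : c ^+ (p ^ e) = 0.
  move/eqP: c0; rewrite expf_eq0 q_gt0 => /eqP->.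
  by exists z; rewrite // add0r.
move: yE; rewrite (frobD (pchar_frac charA)) expr1 => yE.
have hcq : hom 0 (c ^+ (p ^ e)) by rewrite -(muln0 (p ^ e)%N); apply: homX.
have hzq : tpoly (t ^+ (p ^ e).-1 * z ^+ (p ^ e)).
  by apply: tpolyM; apply: tpolyX => //; apply: tpoly_t.
apply: (tpoly_const_eq0 hcq (z := y + (- 1)%:F * (t ^+ (p ^ e).-1 * z ^+ (p ^ e)))).
  by apply/tpolyD/tpolyM => //; apply: tpoly_tofrac.
rewrite mulrDr -yE tofracN tofrac1 mulrCA mulN1r mulrA -exprS prednK ?q_gt0//.
by rewrite exprMn addrK.
Qed.

Lemma tpoly_separated b : (forall n, tdiv tpoly t n b) -> b = 0.
Proof.
move=> hb; have [j [a aE _]] := tdiv_tpoly (hb 0%N).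
suff a0 : a = 0.
  by apply/eqP; move/eqP: aE; rewrite a0 tofrac0 mulf_eq0 (negPf (xX_neq0 j)).
rewrite -(horner_components a) (_ : components a = 0) ?horner0//.
apply/polyP=> l; rewrite coef0.
by apply: (order_geP (tdiv_tpoly (hb l.+1)) aE); rewrite ltnS leq_addr.
Qed.

Lemma tpoly_residues : exists F : seq K, forall b, tpoly b ->
  exists2 r, r \in F & tdiv tpoly t 1 (b - r).
Proof.
have [s sP] := hom0_finite; exists s => _ [|c z hc hz].
  exists 0; first exact/sP/hom0.
  by rewrite subrr; exists 0; rewrite ?mulr0//; apply: TPoly0.
by exists c; [apply: sP | exists z; rewrite // [c + _]addrC addrK].
Qed.

(** Surjectivity modulo [t] suffices, as constants congruent modulo [t] are
    equal. *)
Lemma hom0_frob_surj e c : hom 0 c -> exists2 c', hom 0 c' & c = c' ^+ (p ^ e).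
Proof.
move=> hc; have [F FP] := tpoly_residues.
have [_ [|c' z hc' hz]] := residue_frob_surj charA tpoly_tofrac tpolyD tpolyM FP
    tpoly_reduced e (tpolyC hc).
  rewrite (frob0 (pchar_frac charA)) subr0 => -[y hy]; rewrite expr1.
  move/(tpoly_const_eq0 hc hy) => ->; exists 0; first exact: hom0.
  by rewrite (frob0 (pchar_frac charA)).
move=> [y hy yE]; exists c' => //; apply/subr0_eq.
have hcq : hom 0 (c' ^+ (p ^ e)) by rewrite -(muln0 (p ^ e)%N); apply: homX.
have hzq : tpoly (t ^+ (p ^ e).-1 * z ^+ (p ^ e)).
  by apply: tpolyM; apply: tpolyX => //; apply: tpoly_t.
apply: (tpoly_const_eq0 (homB hc hcq) (tpolyD hy hzq)).
rewrite mulrDr mulrA -exprS prednK ?q_gt0// -[t * y](congr1 (fun u => u * y) (expr1 t)) -yE.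
by rewrite (frobD (pchar_frac charA)) exprMn; ring.
Qed.

(** Multiplication by [t] shifts the coordinates cyclically, the one that wraps
    around being multiplied by [t]. *)
Lemma tpoly_frob_gen e b : tpoly b ->
  exists2 f : nat -> K, forall i, tpoly (f i) & b = frob_comb p t e f.
Proof.
have frobD' f g : frob_comb p t e f + frob_comb p t e g = frob_comb p t e (fun i => f i + g i).
  rewrite -[frob_comb p t e f]mul1r -{1}(expr1n _ (p ^ e)) -(frob_comb_linear charA).
  by apply: eq_frob_comb => i _; rewrite mul1r.
elim=> [|c z hc hz [f fB ->]].
  exists (fun=> 0) => [i|]; first exact: TPoly0.
  by rewrite (frob_comb0 charA).
have [c' hc' ->] := hom0_frob_surj e hc.
exists (fun i => (if i is 0 then c' else 0) + (if i is j.+1 then f j else t * f (p ^ e).-1)).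
  move=> i; apply: tpolyD; case: i => [|i] //; first exact: tpolyC.
  - exact: TPoly0.
  - exact: tpolyT.
rewrite -frobD' /frob_comb -(prednK (q_gt0 e)) /=; congr (_ + _).
  rewrite big_ord_recl big1 ?addr0 ?mul1r// => i _ /=.
  by rewrite prednK ?q_gt0// (frob0 (pchar_frac charA)) mulr0.
rewrite big_ord_recr [RHS]big_ord_recl /= mul1r mulrDr mulr_sumr addrC [(t * _) ^+ _]exprMn.
by congr (_ + _); [rewrite mulrA -exprS | apply: eq_bigr => i _; rewrite mulrA -exprS].
Qed.

Lemma tpoly_conductor : exists c, forall z, tdiv tpoly t c z -> exists a, z = a%:F.
Proof.
have [N NP] := hom_large; exists N => _ [b hb ->].
(* The exponent of [t] grows with each coefficient that is split off. *)
suff key i : (N <= i)%N -> exists a, t ^+ i * b = a%:F by apply: key.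
elim: hb i => [|c z hc _ IH] i Ni.
  by exists 0; rewrite mulr0 tofrac0.
have [|a aG aE] := NP i (t ^+ i * c) Ni.
  by rewrite -{1}[i]addn0; apply: homM (hom_tX i) hc.
have [a' a'E] := IH i.+1 (leqW Ni).
by exists (a + a'); rewrite mulrDr aE mulrA -exprSr a'E tofracD.
Qed.

Lemma ffrt_of_graded_parameter : finite_F_representation_type charA.
Proof.
have [F FP] := tpoly_residues; have [c cP] := tpoly_conductor.
exact: (@ffrt_of_frobenius_parameter A p charA tpoly t tpoly_tofrac tpolyD tpolyM
  t_neq0 tpoly_t c cP noethA F FP tpoly_frob_gen tpoly_reduced tpoly_separated).
Qed.

End HomogeneousLocalization.

End Graded.

Lemma ffrt_graded (A : idomainType) (k : finFieldType) (p : nat) (charA : p \in [pchar A]) :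
    noetherian A -> krull_dim_eq A 1 -> graded_over A k ->
  finite_F_representation_type charA.
Proof.
move=> noethA dimA [G [gradG gcdG [iota G0k]]].
have [j [[x w] /= [xG wG] [x0 w0]]] := consecutive_degrees gradG gcdG.
exact: (ffrt_of_graded_parameter gradG G0k noethA dimA (d := j.+1) xG x0 wG w0).
Qed.

Theorem theorem3p5 (p : nat) (A : idomainType) (charA : p \in [pchar A]%R)
    (k : finFieldType) :
  noetherian A ->
  krull_dim_eq A 1 ->
  complete_local A k \/ graded_over A k ->
  finite_F_representation_type charA.
Proof.
move=> noethA dimA [localA|gradedA].
  exact: (ffrt_complete_local noethA dimA charA localA).
exact: (ffrt_graded charA noethA dimA gradedA).
Qed.
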